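(* Let $S$ be a set. The algebra homomorphism $\rho:\mathrm{NC}_{\mathcal{CRF}_S}\to \mathrm{H}_{\mathcal{CRF}_S}$ determined by $\rho(X_\alpha)=\kappa_\alpha$ for all $\alpha\in K_0^+(\mathcal{CRF}_S)$ is a Hopf algebra homomorphism.
   Context: A rooted tree colored by $S$ is a (finite, nonempty) tree $T$ with vertex set $V(T)$, edge set $E(T)$, a distinguished vertex $r(T)\in V(T)$ (the root) and a map $l:V(T)\to S$ (the coloring). Isomorphisms of colored rooted trees preserve roots, colors and incidences. A rooted forest colored by $S$ is either empty (denoted $\emptyset$) or a finite collection $F=\{T_1,\dots,T_n\}$ of such trees; two forests are isomorphic if their trees can be matched by a bijection into pairwise isomorphic trees. $\mathrm{Iso}(\mathcal{CRF}_S)$ is the set of isomorphism classes of rooted forests colored by $S$, and $\oplus$ denotes disjoint union of forests. An admissible cut $C$ of a tree $T$ is either a subset $C\subset E(T)$ such that any path from a leaf to the root contains at most one edge of $C$, or the full cut $C_{full}$. Removing the edges of $C$ divides $T$ into the component $R_C(T)$ containing the root, and the colored rooted forest $P_C(T)$ of the remaining components (each rooted at its vertex closest to $r(T)$). For the empty cut, $P=\emptyset$ and $R=T$; for the full cut, $P=T$ and $R=\emptyset$. An admissible cut of a forest $F=\{T_1,\dots,T_k\}$ is a collection $C=\{C_1,\dots,C_k\}$ of admissible cuts $C_i$ of $T_i$, with $P_C(F)=\bigcup_i P_{C_i}(T_i)$ and $R_C(F)=\{R_{C_1}(T_1),\dots,R_{C_k}(T_k)\}$ (omitting empty entries). The subobjects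 $A\subset M$ of a forest $M$ are the forests $A=P_C(M)$, one for each admissible cut $C$ of $M$, and the corresponding quotient is $M/A=R_C(M)$. The Grothendieck group $K_0(\mathcal{CRF}_S)$ is the free abelian group on $\mathrm{Iso}(\mathcal{CRF}_S)$ modulo the relations $F=P_C(F)+R_C(F)$ for all forests $F$ and admissible cuts $C$ of $F$; $[A]$ denotes the class of $A$. It is isomorphic to the free abelian group on $S$ (basis $e_s$, $s\in S$), with $[A]=\sum_s v(A,s)e_s$ where $v(A,s)$ is the number of vertices of $A$ of color $s$. $K_0^+(\mathcal{CRF}_S)$ is the cone of effective classes, i.e. the elements $\sum_s a_s e_s$ with all $a_s\in\mathbb{Z}_{\ge 0}$ (finitely many nonzero). The Ringel–Hall algebra $\mathrm{H}_{\mathcal{CRF}_S}$ is the $\mathbb{Q}$-vector space of finitely supported functions $f:\mathrm{Iso}(\mathcal{CRF}_S)\to\mathbb{Q}$, with basis the delta functions $\delta_A$, product $(f\star g)(M)=\sum_{A\subset M}f(A)\,g(M/A)$ (sum over subobjects, i.e. over admissible cuts of $M$), unit $\delta_\emptyset$, coproduct $\Delta(f)(M,N)=f(M\oplus N)$ (where $\delta_A\otimes\delta_B$ is identified with the delta function at $(A,B)$), and counit $f\mapsto f(\emptyset)$. It is a Hopf algebra, graded by $K_0^+(\mathcal{CRF}_S)$ with $\deg\delta_A=[A]$. For $\alpha\in K_0^+(\mathcal{CRF}_S)$, $\kappa_\alpha:=\sum_{A\in\mathrm{Iso}(\mathcal{CRF}_S),\,[A]=\alpha}\delta_A$. $\mathrm{NC}_{\mathcal{CRF}_S}$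 is the free associative unital $\mathbb{Q}$-algebra on generators $X_\alpha$, $\alpha\in K_0^+(\mathcal{CRF}_S)\setminus\{0\}$, with the convention $X_0=1$, graded by $\deg X_\alpha=\alpha$, and with coproduct the algebra homomorphism determined by $\Delta(X_\gamma)=\sum_{\alpha+\beta=\gamma,\ \alpha,\beta\in K_0^+(\mathcal{CRF}_S)}X_\alpha\otimes X_\beta$ and counit $X_\alpha\mapsto 0$ for $\alpha\neq0$. It is a connected graded bialgebra, hence a Hopf algebra. *)

(* Defs.v *)
From HB Require Import structures.
From mathcomp Require Import all_boot all_order all_algebra finmap.
From mathcomp Require Import mathcomp_extra boolp classical_sets functions.
From mathcomp Require Import cardinality fsbigop.
From mathcomp.multinomials Require Import monalg.

Set Implicit Arguments.
Unset Strict Implicit.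
Unset Printing Implicit Defensive.

Import GRing.Theory.
Local Open Scope ring_scope.
Local Open Scope quotient_scope.

(* -------------------------------------------------------------------- *)
(* A rooted forest on a finite vertex set V is given by its parent map: the
   roots are the vertices with no parent, the edges are the pairs formed by a
   non-root vertex and its parent, and the trees are the connected
   components.  Hence a non-root vertex also names the edge above it. *)
Section Parent.
Variables (V : finType) (p : V -> option V).

Definition to_parent : rel V := [rel v w | p v == Some w].

(* Includes the case u = v. *)
Definition ancestor (u v : V) : bool := connect to_parent v u.

Definition acyclic : bool :=
  [forall v, forall w, to_parent v w ==> ~~ ancestor v w].

Lemma acyclic_rank (h : V -> nat) :
  (forall v w, p v = Some w -> (h w < h v)%N) -> acyclic.
Proof.
move=> hp; apply/forallP => v; apply/forallP => w; apply/implyP => /eqP vw.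
apply/negP => /connectP [s]; elim: s w {vw}(hp _ _ vw) => [|x s IHs] w hw /=.
  by move=> _ vw; rewrite vw ltnn in hw.
by move=> /andP [/eqP /hp xw ws] vE; apply: (IHs x) => //; apply: ltn_trans hw.
Qed.

Lemma acyclicP : acyclic ->
  exists h : V -> nat, forall v w, p v = Some w -> (h w < h v)%N.
Proof.
move=> /forallP acp; exists (fun v => #|connect to_parent v|) => v w vw.
have vw' : to_parent v w by apply/eqP.
apply: proper_card; apply/properP; split.
  by apply/fintype.subsetP => x wx; apply: connect_trans wx; apply: connect1.
exists v; first exact: connect0.
by have /forallP /(_ w) /implyP /(_ vw') := acp v.
Qed.

End Parent.

(* -------------------------------------------------------------------- *)
Section Forests.
Variable S : Type.

(* Up to isomorphism the vertex set can be taken to be {0, ..., n-1}. *)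
Record forest := Forest {
  nb_vertices : nat;
  parent : 'I_nb_vertices -> option 'I_nb_vertices;
  color : 'I_nb_vertices -> S;
  acyclic_parent : acyclic parent
}.

HB.instance Definition _ := gen_eqMixin forest.
HB.instance Definition _ := gen_choiceMixin forest.

Definition vert (F : forest) : finType := 'I_(nb_vertices F).

Section MkForest.
Variables (V : finType) (p : V -> option V) (c : V -> S) (acp : acyclic p).

Definition mk_parent (i : 'I_#|V|) : option 'I_#|V| :=
  omap enum_rank (p (enum_val i)).

Fact acyclic_mk_parent : acyclic mk_parent.
Proof.
have [h hp] := acyclicP acp.
apply: (@acyclic_rank _ _ (h \o enum_val)) => v w; rewrite /mk_parent /=.
by case E: (p _) => [x|] //= [<-]; rewrite enum_rankK; apply: hp.
Qed.

Definition mkforest : forest :=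
  Forest (fun i => c (enum_val i)) acyclic_mk_parent.

End MkForest.

Definition forest_iso (F G : forest) : Prop :=
  exists f : vert F -> vert G,
    [/\ bijective f,
        forall v, parent (f v) = omap f (parent v) &
        forall v, color (f v) = color v].

Lemma forest_iso_refl F : forest_iso F F.
Proof.
exists id; split=> //; first by exists id.
by move=> v; case: (parent v).
Qed.

Lemma forest_iso_sym F G : forest_iso F G -> forest_iso G F.
Proof.
move=> [f [[g fK gK] fp fc]]; exists g; split; first by exists f.
  move=> v; rewrite -{2}(gK v) fp; case: (parent _) => //= x.
  by rewrite fK.
by move=> v; rewrite -fc gK.
Qed.

Lemma forest_iso_trans F G H :
  forest_iso F G -> forest_iso G H -> forest_iso F H.
Proof.
move=> [f [fb fp fc]] [g [gb gp gc]]; exists (g \o f); split.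
- exact: bij_comp.
- by move=> v /=; rewrite gp fp; case: (parent v).
- by move=> v /=; rewrite gc fc.
Qed.

Definition forest_isob (F G : forest) : bool := `[< forest_iso F G >].

Fact forest_isob_equiv : equiv_class_of forest_isob.
Proof.
split=> [F|F G|G F H].
- exact/asboolP/forest_iso_refl.
- by apply/asboolP/asboolP; apply: forest_iso_sym.
- by move=> /asboolP FG /asboolP GH; apply/asboolP/(forest_iso_trans FG GH).
Qed.

Canonical forest_isob_equivRel := EquivRelPack forest_isob_equiv.

Definition forest_quot := {eq_quot forest_isob}.

(* The choice structure of forest_quot is replaced by one that does not
   compute, which keeps unification in {malg _[Iso]} fast. *)
Definition Iso : choiceType := {classic forest_quot}.

Definition iso_class (F : forest) : Iso := \pi_forest_quot F.

Definition representative (A : Iso) : forest := repr (A : forest_quot).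

Lemma representativeK A : iso_class (representative A) = A.
Proof. exact: reprK. Qed.

Lemma iso_classP F G : iso_class F = iso_class G <-> forest_iso F G.
Proof.
split=> FG.
  suff /asboolP : forest_isob F G by [].
  exact/(@eqquotP _ _ forest_quot).
by apply/(@eqquotP _ _ forest_quot)/asboolP.
Qed.

Fact acyclic_none : @acyclic void (fun=> None).
Proof. by apply: (@acyclic_rank _ _ (fun=> 0%N)). Qed.

Definition empty_forest : forest :=
  mkforest (fun v : void => match v with end) acyclic_none.

Fact acyclic_unit : @acyclic unit (fun=> None).
Proof. by apply: (@acyclic_rank _ _ (fun=> 0%N)). Qed.

Definition vertex_forest (s : S) : forest := mkforest (fun=> s) acyclic_unit.

Definition union_parent F G (x : vert F + vert G) :
    option (vert F + vert G) :=
  match x with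
  | inl v => omap inl (parent v)
  | inr v => omap inr (parent v)
  end.

Definition union_color F G (x : vert F + vert G) : S :=
  match x with inl v => color v | inr v => color v end.

Fact acyclic_union F G : acyclic (@union_parent F G).
Proof.
have [h hp] := acyclicP (acyclic_parent F).
have [k kp] := acyclicP (acyclic_parent G).
apply: (@acyclic_rank _ _ (fun x => match x with inl v => h v | inr v => k v end)).
move=> [v|v] w /=; case E: (parent v) => [x|] //= [<-].
  exact: hp.
exact: kp.
Qed.

Definition union_forest F G : forest :=
  mkforest (@union_color F G) (acyclic_union F G).

Definition oplus (A B : Iso) : Iso :=
  iso_class (union_forest (representative A) (representative B)).

(* -------------------------------------------------------------------- *)
Section Cuts.
Variable F : forest.

Definition forest_roots : {set vert F} := [set v | parent v == None].

Definition forest_leaves : {set vert F} :=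
  [set v | [forall w, parent w != Some v]].

(* A cut of F chooses, for each tree of F, either the full cut or a set of
   edges.  C.1 is the set of roots of the fully cut trees; C.2 is the set of
   all chosen edges, each named by its lower endpoint. *)
Definition cut : finType := ({set vert F} * {set vert F})%type.

Definition admissible (C : cut) : bool :=
  [&& C.1 \subset forest_roots, C.2 \subset ~: forest_roots,
      [forall r in C.1, forall v in C.2, ~~ ancestor (@parent F) r v] &
      [forall l in forest_leaves,
         (#|[set v in C.2 | ancestor (@parent F) v l]| <= 1)%N]].

Definition pruned_set (C : cut) : {set vert F} :=
  [set v | [exists u in C.1 :|: C.2, ancestor (@parent F) u v]].

(* The forest with vertex set U left after removing the edges E. *)
Section Part.
Variables (E U : {set vert F}).

Definition part_parent (v : {v | v \in U}) : option {v | v \in U} :=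
  if val v \in E then None else obind insub (parent (val v)).

Fact acyclic_part : acyclic part_parent.
Proof.
have [h hp] := acyclicP (acyclic_parent F).
apply: (@acyclic_rank _ _ (h \o val)) => v w; rewrite /part_parent.
case: ifP => // _; case Ep: (parent _) => [x|] //=.
by case: insubP => // y _ yx [<-]; apply: hp; rewrite Ep -yx.
Qed.

Definition part : forest :=
  mkforest (fun v : {v | v \in U} => color (val v)) acyclic_part.

End Part.

Definition cutP (C : cut) : forest := part C.2 (pruned_set C).
Definition cutR (C : cut) : forest := part C.2 (~: pruned_set C).

End Cuts.

(* -------------------------------------------------------------------- *)
Definition K0_relator (F : forest) (C : cut F) : {malg int[Iso]} :=
  << iso_class F >> - (<< iso_class (cutP C) >> + << iso_class (cutR C) >>).

(* The smallest subgroup containing the relators of admissible cuts. *)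
Definition K0_relations : {pred {malg int[Iso]}} :=
  fun x => `[< forall N : {pred {malg int[Iso]}}, zmod_closed N ->
    (forall F (C : cut F), admissible C -> K0_relator C \in N) -> x \in N >].

Fact K0_relations_closed : zmod_closed K0_relations.
Proof.
split=> [|x y /asboolP xN /asboolP yN]; apply/asboolP => N N0 NR.
  by have [] := N0.
by have [_ NB] := N0; apply: NB; [apply: xN | apply: yN].
Qed.

HB.instance Definition _ :=
  GRing.isZmodClosed.Build {malg int[Iso]} K0_relations K0_relations_closed.

Definition K0 : zmodType := Quotient.quot K0_relations.

Definition K0_class (A : Iso) : K0 := \pi_K0 << A >>.

Definition K0_basis (s : S) : K0 := K0_class (iso_class (vertex_forest s)).

Definition effective : {pred K0} :=
  fun x => `[< exists (l : seq S) (a : S -> nat),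
                 x = \sum_(s <- l) K0_basis s *+ a s >].

Definition K0plus : choiceType := {x : K0 | x \in effective}.

End Forests.

Arguments oplus {S}.
Arguments K0_class {S}.

(* -------------------------------------------------------------------- *)
(* Spaces with a chosen basis K are represented by {malg rat[K]}, the
   finitely supported functions K -> rat; the tensor product of two of them is
   {malg rat[K * L]}, the delta function at (k, l) being << k >> (x) << l >>. *)
Section BasedSpaces.

(* The finitely supported function with values f k (and 0 if f does not have
   a finite support; the uses below do have one, see hall_mulE and
   hall_comulE). *)
Definition of_fun (K : choiceType) (f : K -> rat) : {malg rat[K]} :=
  \sum_(k \in [set: K]%classic) << f k *g k >>.

Definition linext (K : choiceType) (M : lmodType rat) (h : K -> M)
    (x : {malg rat[K]}) : M :=
  \sum_(k <- msupp x) x@_k *: h k.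

Definition tens (K L : choiceType) (x : {malg rat[K]}) (y : {malg rat[L]}) :
    {malg rat[(K * L)%type]} :=
  \sum_(k <- msupp x) \sum_(l <- msupp y) << x@_k * y@_l *g (k, l) >>.

Definition tensmap (K L K' L' : choiceType)
    (f : {malg rat[K]} -> {malg rat[K']}) (g : {malg rat[L]} -> {malg rat[L']}) :
    {malg rat[(K * L)%type]} -> {malg rat[(K' * L')%type]} :=
  linext (fun p => tens (f << p.1 >>) (g << p.2 >>)).

End BasedSpaces.

(* -------------------------------------------------------------------- *)
Record bialgebra_ops (K : choiceType) := BialgebraOps {
  hmul : {malg rat[K]} -> {malg rat[K]} -> {malg rat[K]};
  hone : {malg rat[K]};
  hcomul : {malg rat[K]} -> {malg rat[(K * K)%type]};
  hcounit : {malg rat[K]} -> rat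
}.

Section HopfMorphism.
Variables (K L : choiceType) (A : bialgebra_ops K) (B : bialgebra_ops L).

Definition convolution (f g : {malg rat[K]} -> {malg rat[K]}) :
    {malg rat[K]} -> {malg rat[K]} :=
  fun x => linext (fun p => hmul A (f << p.1 >>) (g << p.2 >>)) (hcomul A x).

Definition is_antipode (s : {linear {malg rat[K]} -> {malg rat[K]}}) : Prop :=
  forall x, convolution s id x = hcounit A x *: hone A /\
            convolution id s x = hcounit A x *: hone A.

Definition is_algebra_hom
    (f : {linear {malg rat[K]} -> {malg rat[L]}}) : Prop :=
  f (hone A) = hone B /\ forall x y, f (hmul A x y) = hmul B (f x) (f y).

Definition is_coalgebra_hom
    (f : {linear {malg rat[K]} -> {malg rat[L]}}) :
    Prop :=
  (forall x, hcomul B (f x) = tensmap f f (hcomul A x)) /\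
  (forall x, hcounit B (f x) = hcounit A x).

End HopfMorphism.

Definition is_Hopf_hom (K L : choiceType) (A : bialgebra_ops K)
    (B : bialgebra_ops L) (f : {linear {malg rat[K]} -> {malg rat[L]}}) : Prop :=
  [/\ is_algebra_hom A B f, is_coalgebra_hom A B f &
      forall sA sB, is_antipode A sA -> is_antipode B sB ->
        forall x, f (sA x) = sB (f x)].

(* -------------------------------------------------------------------- *)
Section HallAlgebra.
Variable S : Type.

Definition hall : lmodType rat := {malg rat[Iso S]}.

Definition hall_mul (f g : hall) : hall :=
  of_fun (fun M : Iso S => \sum_(C : cut (representative M) | admissible C)
    f@_(iso_class (cutP C)) * g@_(iso_class (cutR C))).

Definition hall_comul (f : hall) : {malg rat[(Iso S * Iso S)%type]} :=
  of_fun (fun p => f@_(oplus p.1 p.2)).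

Definition hall_one : hall := << iso_class (empty_forest S) >>.

Definition hall_counit (f : hall) : rat := f@_(iso_class (empty_forest S)).

Definition hall_ops : bialgebra_ops (Iso S) :=
  BialgebraOps hall_mul hall_one hall_comul hall_counit.

Definition kappa (a : K0plus S) : hall :=
  \sum_(A \in [set A : Iso S | K0_class A = val a]%classic)
    (<< A >> : {malg rat[Iso S]}).

End HallAlgebra.

(* -------------------------------------------------------------------- *)
Section ProdMonom.
Variables M N : monomType.

Definition pmone : M * N := (mone, mone).
Definition pmmul (x y : M * N) : M * N := (mmul x.1 y.1, mmul x.2 y.2).

Fact pmmulA : associative pmmul.
Proof. by move=> x y z; rewrite /pmmul /= !mulmA. Qed.

Fact pmmul1m : left_id pmone pmmul.
Proof. by move=> [x y]; rewrite /pmmul /= !mul1m. Qed.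

Fact pmmulm1 : right_id pmone pmmul.
Proof. by move=> [x y]; rewrite /pmmul /= !mulm1. Qed.

Fact pmunitm x y : pmmul x y = pmone -> x = pmone /\ y = pmone.
Proof. by case: x y => [? ?] [? ?] [/unitm [-> ->] /unitm [-> ->]]. Qed.

(* With this product {malg rat[M * N]} is the tensor product algebra. *)
HB.instance Definition _ :=
  Choice_isMonomialDef.Build (M * N)%type pmmulA pmmul1m pmmulm1 pmunitm.

End ProdMonom.

(* -------------------------------------------------------------------- *)
(* The free associative algebra on a set is the monoid algebra of the free
   monoid, whose elements are the words {fmonom _}. *)
Section NC.
Variable S : Type.

Definition generator : choiceType := {a : K0plus S | val a != 0}.
Definition word : monomType := {fmonom generator}.

Definition NC := {malg rat[word]}.

(* X 0 = 1. *)
Definition X (a : K0plus S) : NC :=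
  if insub a is Some g then << fmu (g : generator) >> else 1.

Definition comul_gen (c : K0plus S) : {malg rat[(word * word)%type]} :=
  \sum_(p \in [set p : K0plus S * K0plus S |
                 val p.1 + val p.2 = val c]%classic) tens (X p.1) (X p.2).

Definition NC_comul : NC -> {malg rat[(word * word)%type]} :=
  linext (fun w : word => \prod_(g <- (w : {fmonom generator})) comul_gen (val g)).

(* The algebra morphism sending every generator to 0. *)
Definition NC_counit (x : NC) : rat := x@_(mone : word).

Definition NC_ops : bialgebra_ops word :=
  BialgebraOps (fun x y : NC => x * y) 1 NC_comul NC_counit.

End NC.

(* -------------------------------------------------------------------- *)
(* The sums above that range over infinite sets have finite support, so that
   they have the expected values. *)
Section FiniteSupport.
Local Open Scope classical_set_scope.

Lemma of_funE (K : choiceType) (f : K -> rat) k :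
  finite_set [set i | f i != 0] -> (of_fun f)@_k = f k.
Proof.
move=> finf; rewrite /of_fun raddf_sum /=.
under eq_bigr do rewrite mcoeffU.
have mem i : (i \in finite_support 0 [set: K] (fun i => << f i *g i >>))
    = (f i != 0).
  rewrite in_finite_support.
    apply/idP/idP => [/set_mem [_ /=]|fi].
      by apply: contra_notN => /eqP ->; rewrite monalgU0.
    apply/mem_set; split=> //= /(congr1 (mcoeff i)).
    by rewrite mcoeffUU mcoeff0 => /eqP; apply/negP.
  apply: sub_finite_set finf => j [_ /=]; apply: contra_notN => /eqP ->.
  by rewrite monalgU0.
have [fk0|fk] := eqVneq (f k) 0.
  rewrite fk0 big1 // => i _; have [->|_] := eqVneq i k; last by rewrite mulr0n.
  by rewrite fk0 mul0rn.
rewrite (bigD1_seq k) ?mem ?finite_support_uniq //= eqxx mulr1n.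
by rewrite big1 ?addr0 // => i /negbTE ->; rewrite mulr0n.
Qed.

Variable S : Type.
Implicit Types (q : pred S) (F G : forest S) (A B M : Iso S).

Definition nb_vert q F : nat := (\sum_(v : vert F) q (color v))%N.

Lemma nb_vert_mk q (V : finType) (p : V -> option V) (c : V -> S) acp :
  nb_vert q (@mkforest _ V p c acp) = (\sum_v q (c v))%N.
Proof.
rewrite /nb_vert (reindex_onto (@enum_rank V) enum_val) /=; last first.
  by move=> i _; rewrite enum_valK.
apply: eq_big => [v|v _]; first by rewrite enum_rankK eqxx.
by rewrite /= enum_rankK.
Qed.

Lemma nb_vert_iso q F G : forest_iso F G -> nb_vert q F = nb_vert q G.
Proof.
move=> [f [fb _ fc]]; rewrite /nb_vert [RHS](reindex f) /=; last exact: onW_bij.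
by apply: eq_bigr => v _; rewrite fc.
Qed.

Lemma representative_iso F : forest_iso (representative (iso_class F)) F.
Proof. exact/iso_classP/representativeK. Qed.

Lemma nb_vert_repr q F : nb_vert q (representative (iso_class F)) = nb_vert q F.
Proof. exact/nb_vert_iso/representative_iso. Qed.

Lemma nb_vert_union q F G :
  nb_vert q (union_forest F G) = (nb_vert q F + nb_vert q G)%N.
Proof. by rewrite nb_vert_mk big_sumType. Qed.

Lemma nb_vert_oplus q A B : nb_vert q (representative (oplus A B)) =
  (nb_vert q (representative A) + nb_vert q (representative B))%N.
Proof. by rewrite nb_vert_repr nb_vert_union. Qed.

Lemma nb_vert_part q F (E U : {set vert F}) :
  nb_vert q (part E U) = (\sum_(v in U) q (color v))%N.
Proof. by rewrite nb_vert_mk [RHS]big_sub. Qed.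

Lemma nb_vert_cut q F (C : cut F) :
  nb_vert q F = (nb_vert q (cutP C) + nb_vert q (cutR C))%N.
Proof.
rewrite !nb_vert_part /nb_vert (bigID (mem (pruned_set C))) /=. congr addn.
by apply: eq_bigl => v; rewrite finset.in_setC.
Qed.

Lemma finite_le_nb_vert A : finite_set
  [set B : Iso S | forall q, (nb_vert q (representative B) <= nb_vert q (representative A))%N].
Proof.
pose g m (x : {ffun 'I_m -> option 'I_m} * {ffun 'I_m -> vert (representative A)}) :=
  match boolP (acyclic x.1) with
  | AltTrue acx => iso_class (Forest (fun v => color (x.2 v)) acx)
  | AltFalse _ => A
  end.
pose n := nb_vertices (representative A).
have nE (F : forest S) : nb_vertices F = nb_vert predT F.
  by rewrite /nb_vert sum1_card card_ord.
apply: (@sub_finite_set _ _ (\bigcup_(m in `I_n.+1) range (g m))); last first.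
  apply: bigcup_finite => // m _; apply: finite_image.
  exact: finite_finset.
move=> B leBA; exists (nb_vertices (representative B)) => /=.
  by rewrite ltnS /n !nE.
have /choice [h hE] : forall v : vert (representative B),
    exists w : vert (representative A), color w = color v.
  move=> v; apply/asboolP.
  have := leBA (fun s => ~~ `[< exists w : vert (representative A), color w = s >]).
  rewrite [X in (_ <= X)%N]big1 => [|w _]; last first.
    by apply/eqP; rewrite eqb0 negbK; apply/asboolP; exists w.
  by rewrite leqn0 sum_nat_eq0 => /forallP /(_ v) /=; rewrite eqb0 negbK.
exists ([ffun v => parent v], [ffun v => h v]) => //.
rewrite /g; case: {-}_ / boolP => [acx|/negP []].
  transitivity (iso_class (representative B)); last exact: representativeK.
  apply/iso_classP; exists id; split; first by exists id.
    by move=> v /=; rewrite ffunE; case: parent.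
  by move=> v /=; rewrite ffunE hE.
have [k kp] := acyclicP (@acyclic_parent _ (representative B)).
by apply: (@acyclic_rank _ _ k) => v w; rewrite ffunE; apply: kp.
Qed.

Lemma hall_mulE (f g : hall S) M : (hall_mul f g)@_M =
  \sum_(C : cut (representative M) | admissible C)
    f@_(iso_class (cutP C)) * g@_(iso_class (cutR C)).
Proof.
apply: of_funE; pose D := \bigcup_(A in [set` msupp f])
  \bigcup_(B in [set` msupp g])
  [set N : Iso S | forall q, (nb_vert q (representative N) <= nb_vert q (representative (oplus A B)))%N].
apply: (@sub_finite_set _ _ D); last first.
  apply: bigcup_finite => // A _; apply: bigcup_finite => // B _.
  exact: finite_le_nb_vert.
move=> N /=; apply: contraNP => ND; apply/eqP/big1 => C _; apply/eqP.
rewrite mulf_eq0; apply: contra_notT ND; rewrite negb_or => /andP [fC gC].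
exists (iso_class (cutP C)); first by rewrite /= -mcoeff_neq0.
exists (iso_class (cutR C)); first by rewrite /= -mcoeff_neq0.
by move=> q; rewrite nb_vert_oplus !nb_vert_repr -nb_vert_cut.
Qed.

Lemma hall_comulE (f : hall S) A B : (hall_comul f)@_(A, B) = f@_(oplus A B).
Proof.
rewrite of_funE //; pose D (N : Iso S) := [set A : Iso S | forall q,
  (nb_vert q (representative A) <= nb_vert q (representative N))%N].
apply: (@sub_finite_set _ _ (\bigcup_(N in [set` msupp f]) (D N `*` D N))).
  move=> [A' B'] /= fAB; exists (oplus A' B'); first by rewrite /= -mcoeff_neq0.
  by split=> q /=; rewrite nb_vert_oplus ?leq_addr ?leq_addl.
by apply: bigcup_finite => // N _; apply: finite_setX; apply: finite_le_nb_vert.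
Qed.

Definition nb_vert_lin q (x : {malg int[Iso S]}) : int :=
  mmap idfun (fun A => (nb_vert q (representative A))%:R) x.

Lemma nb_vert_linB q x y :
  nb_vert_lin q (x - y) = nb_vert_lin q x - nb_vert_lin q y.
Proof. by rewrite /nb_vert_lin raddfB. Qed.

Lemma nb_vert_lin_class q A : nb_vert_lin q << A >> = (nb_vert q (representative A))%:R.
Proof. by rewrite /nb_vert_lin mmapU /= mul1r. Qed.

Lemma nb_vert_lin_relator q F (C : cut F) : nb_vert_lin q (K0_relator C) = 0.
Proof.
rewrite /K0_relator opprD addrA 2!nb_vert_linB 3!nb_vert_lin_class 3!nb_vert_repr.
by rewrite (nb_vert_cut q C) natrD -addrA -opprD subrr.
Qed.

Lemma K0_class_nb_vert q A B : K0_class A = K0_class B ->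
  nb_vert q (representative A) = nb_vert q (representative B).
Proof.
move=> AB; have : << A >> - << B >> \in @K0_relations S.
  by rewrite Quotient.idealrBE; apply/eqP.
move=> /asboolP /(_ (fun x => nb_vert_lin q x == 0)).
rewrite unfold_in /= nb_vert_linB 2!nb_vert_lin_class subr_eq0 !natz eqz_nat.
move=> H; apply/eqP/H; last by move=> F C _; rewrite unfold_in nb_vert_lin_relator.
split=> [|x y]; first by rewrite unfold_in /nb_vert_lin raddf0.
by rewrite !unfold_in nb_vert_linB => /eqP -> /eqP ->; rewrite subrr.
Qed.

Lemma finite_K0_class (a : K0 S) : finite_set [set A | K0_class A = a].
Proof.
have [[A Aa]|nA] := pselect (exists A, K0_class A = a); last first.
  by apply: (@sub_finite_set _ _ set0) => // A Aa; case: nA; exists A.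
apply: sub_finite_set (finite_le_nb_vert A) => B /= Ba q.
by rewrite (@K0_class_nb_vert q B A) // Aa Ba.
Qed.

Lemma kappaE (a : K0plus S) A : (kappa a)@_A = (K0_class A == val a)%:R.
Proof.
rewrite /kappa raddf_sum /=; under eq_bigr do rewrite mcoeffU.
have finA : finite_set ([set A | K0_class A = val a] `&`
    (fun A => << A >> : {malg rat[Iso S]}) @^-1` [set~ 0]).
  exact/finite_setIl/finite_K0_class.
have mem B : (B \in finite_support 0 [set A | K0_class A = val a]
    (fun A => << A >> : {malg rat[Iso S]})) = (K0_class B == val a).
  rewrite in_finite_support //; apply/idP/eqP => [/set_mem []//|Ba].
  apply/mem_set; split=> //= /(congr1 (mcoeff B)).
  by rewrite mcoeffUU mcoeff0 => /eqP; rewrite oner_eq0.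
have [Aa|Aa] := boolP (K0_class A == val a).
  rewrite (bigD1_seq A) ?mem ?finite_support_uniq //= eqxx.
  by rewrite big1 ?addr0 // => B /negbTE ->.
rewrite big_seq big1 // => B; rewrite mem => Ba.
by case: eqVneq => // BA; rewrite -BA Ba in Aa.
Qed.

Lemma part_iso F G (U : {set vert G}) (f : vert F -> vert G) :
    injective f -> U = [set f v | v : vert F]%SET ->
    (forall v, parent (f v) = omap f (parent v)) ->
    (forall v, color (f v) = color v) ->
  forest_iso F (part finset.set0 U).
Proof.
move=> fI UE fp fc; have fU v : f v \in U by rewrite UE imset_f.
pose g v : {x | x \in U} := exist _ (f v) (fU v).
have gI : injective (enum_rank \o g).
  by move=> v w /= /enum_rank_inj /(congr1 val) /= /fI.
exists (enum_rank \o g); split.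
- apply: inj_card_bij => //; have -> : #|vert (part finset.set0 U)| = #|U|.
    by rewrite card_ord; exact: card_sig (mem U).
  by rewrite UE card_imset.
- move=> v; rewrite /= /mk_parent enum_rankK /part_parent /= finset.in_set0 fp.
  case: (parent v) => //= w; case: insubP => [y yU yE|/negP []]; last exact: fU.
  by congr (Some (enum_rank _)); apply/val_inj.
- by move=> v /=; rewrite enum_rankK /=.
Qed.

Lemma root_ancestor F (v : vert F) :
  exists2 r, r \in forest_roots F & ancestor (@parent _ F) r v.
Proof.
have [h hp] := acyclicP (@acyclic_parent _ F).
have [n] := ubnP (h v); elim: n v => // n IHn v hv.
case vw: (parent v) => [w|]; last first.
  by exists v; [rewrite inE vw|exact: connect0].
have [r r0 rw] := IHn w (leq_trans (hp _ _ vw) hv).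
by exists r => //; apply: connect_trans rw; apply/connect1/eqP.
Qed.

Section UnionCut.
Variables F G : forest S.
Let H := union_forest F G.
Let inF (v : vert F) : vert H := enum_rank (inl v : vert F + vert G).
Let inG (v : vert G) : vert H := enum_rank (inr v : vert F + vert G).

Let parent_inF v : parent (inF v) = omap inF (parent v).
Proof. by rewrite /= /mk_parent enum_rankK /=; case: (parent v). Qed.

Let parent_inG v : parent (inG v) = omap inG (parent v).
Proof. by rewrite /= /mk_parent enum_rankK /=; case: (parent v). Qed.

Let vertP x : (exists v, x = inF v) \/ (exists v, x = inG v).
Proof.
by rewrite -(enum_valK x); case: (enum_val x) => v; [left|right]; exists v.
Qed.

Let inFG v w : inF v <> inG w.
Proof. by move=> /enum_rank_inj. Qed.

Definition union_cut : cut H := ([set inF r | r in forest_roots F]%SET, finset.set0).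

Lemma union_cut_admissible : admissible union_cut.
Proof.
apply/and4P; split; rewrite /=.
- apply/fintype.subsetP => _ /imsetP [r rF ->].
  by move: rF; rewrite !inE parent_inF => /eqP ->.
- exact: finset.sub0set.
- by apply/forall_inP => r _; apply/forall_inP => v; rewrite finset.in_set0.
- apply/forall_inP => l _; rewrite (_ : [set _ in _ | _]%SET = finset.set0) ?cards0 //.
  by apply/finset.setP => v; rewrite !inE.
Qed.

Lemma pruned_union_cut : pruned_set union_cut = [set inF v | v : vert F]%SET.
Proof.
apply/finset.setP => x; rewrite !inE; apply/idP/idP.
  move=> /existsP [u /andP []]; rewrite finset.setU0 => /imsetP [r _ ->] {u}.
  have [[v ->] _|[v -> /connectP [p]]] := vertP x; first exact: imset_f.
  move=> pv rE; exfalso; elim: p v pv rE => [v _ /inFG //|y p IHp v /andP [/eqP vy]].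
  have : parent (inG v) = Some y by exact: vy.
  by rewrite parent_inG; case: (parent v) => // w [<-]; exact: IHp.
move=> /imsetP [v _ ->] {x}; have [r rF rv] := root_ancestor v.
apply/existsP; exists (inF r); rewrite finset.setU0 imset_f //=.
case/connectP: rv => p; elim: p v => [v _ ->|y p IHp v /andP [/eqP vy yp] rE].
  exact: connect0.
apply: connect_trans (IHp _ yp rE); apply/connect1/eqP.
by rewrite [LHS]parent_inF vy.
Qed.

Lemma K0_class_union :
  K0_class (iso_class H) = K0_class (iso_class F) + K0_class (iso_class G).
Proof.
have -> : iso_class F = iso_class (cutP union_cut).
  apply/iso_classP; apply: (@part_iso _ _ _ inF).
  - by move=> v w /enum_rank_inj [].
  - exact: pruned_union_cut.
  - exact: parent_inF.
  - by move=> v; rewrite /= enum_rankK.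
have -> : iso_class G = iso_class (cutR union_cut).
  apply/iso_classP; apply: (@part_iso _ _ _ inG).
  - by move=> v w /enum_rank_inj [].
  - apply/finset.setP => x; rewrite finset.in_setC pruned_union_cut.
    have [[v ->]|[v ->]] := vertP x.
      rewrite imset_f //=; apply/esym/negbTE/negP => /imsetP [w _].
      exact: inFG.
    rewrite [RHS]imset_f //; apply/negP => /imsetP [w _ /esym].
    exact: inFG.
  - exact: parent_inG.
  - by move=> v; rewrite /= enum_rankK.
rewrite /K0_class -raddfD; apply/eqP; rewrite -Quotient.idealrBE.
by apply/asboolP => N _; apply; exact: union_cut_admissible.
Qed.

End UnionCut.

Lemma K0_class_oplus A B : K0_class (oplus A B) = K0_class A + K0_class B.
Proof. by rewrite K0_class_union !representativeK. Qed.

Lemma forest_iso0 F G :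
  nb_vertices F = 0%N -> nb_vertices G = 0%N -> forest_iso F G.
Proof.
case: F G => [n p c ac] [m p' c' ac'] /= n0 m0; subst n m.
exists id; split; first by exists id.
  by case.
by case.
Qed.

Lemma K0_class_empty : K0_class (iso_class (empty_forest S)) = 0.
Proof.
set e := K0_class _; apply: (addrI e); rewrite addr0 -K0_class_union.
congr K0_class; apply/iso_classP/forest_iso0; rewrite /= ?card_void //.
by rewrite card_sum !card_ord /= card_void.
Qed.

Lemma effectiveP (x : K0 S) : x \in @effective S -> exists A, x = K0_class A.
Proof.
move=> /asboolP [l [a ->]].
have P0 : exists A, 0 = K0_class A :> K0 S.
  by exists (iso_class (empty_forest S)); rewrite K0_class_empty.
have PD (y z : K0 S) : (exists A, y = K0_class A) ->
    (exists A, z = K0_class A) -> exists A, y + z = K0_class A.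
  by move=> [A ->] [B ->]; exists (oplus A B); rewrite K0_class_oplus.
elim/big_ind: _ => // s _; elim: (a s) => [|n IHn]; first by rewrite mulr0n.
by rewrite mulrS; apply: PD => //; exists (iso_class (vertex_forest s)).
Qed.

Lemma finite_K0plus_splittings (c : K0plus S) :
  finite_set [set p : K0plus S * K0plus S | val p.1 + val p.2 = val c].
Proof.
have [C CE] := effectiveP (valP c).
pose D := [set A : Iso S | forall q,
  (nb_vert q (representative A) <= nb_vert q (representative C))%N].
have finE : finite_set [set a : K0plus S | exists2 A, D A & val a = K0_class A].
  pose g A := odflt c (insub (K0_class A)).
  apply: (@sub_finite_set _ _ [set g A | A in D]).
    move=> a [A DA aE]; exists A => //; rewrite /g -aE.
    by rewrite valK.
  exact/finite_image/finite_le_nb_vert.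
apply: (@sub_finite_set _ _ ([set a : K0plus S | exists2 A, D A & val a = K0_class A] `*`
  [set a : K0plus S | exists2 A, D A & val a = K0_class A])).
  move=> [a b] /= ab; have [A AE] := effectiveP (valP a).
  have [B BE] := effectiveP (valP b).
  have nC q : (nb_vert q (representative C) =
      nb_vert q (representative A) + nb_vert q (representative B))%N.
    rewrite -nb_vert_oplus; apply: K0_class_nb_vert.
    by rewrite K0_class_oplus -AE -BE ab.
  split => /=; [exists A => // q|exists B => // q]; rewrite nC.
    exact: leq_addr.
  exact: leq_addl.
exact: finite_setX.
Qed.

End FiniteSupport.

(* Main.v *)
Require Import Defs.
From HB Require Import structures.
From mathcomp Require Import all_boot all_algebra finmap.
From mathcomp Require Import boolp cardinality fsbigop.
From mathcomp.multinomials Require Import monalg.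

(** Everything about the Hall product rests on one dictionary.  An admissible
    cut of a forest F amounts to a set U of vertices closed under taking
    children: U is the pruned part, and the cut consists of the edges (or, for
    fully cut trees, the roots) above the topmost vertices of U.  The pruned
    part and the rest are then the subforests induced on U and on its
    complement (top_cut_pruned, pruned_top_cut, iso_class_cutP,
    iso_class_cutR), so that

      (f * g)(F|W) = sum over U closed in W of f(F|U) g(F|(W \ U)).

    Associativity compares two ways of listing chains T <= U <= W of closed
    sets (hall_mulA).  Hence sending a word to the product of the kappa's of its
    letters defines an algebra homomorphism rho, and the generators X_a force
    its values.

    For the coproduct, closed sets of a disjoint union are pairs of closed sets
    of the summands, and restriction turns such a pair into a direct sum
    (hall_mul_oplus).  Thus the coproduct of the Hall algebra is multiplicative,
    and it suffices to compare both coproducts on generators: evaluated at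
    (A, B), the coproduct of kappa_c is 1 exactly when [A] + [B] = c, which is
    the sum of kappa_a tensor kappa_b over a + b = c.  The splittings a + b = c
    range over effective classes, so this uses that every class [A] is effective
    (K0_class_effective), seen by removing one deepest vertex at a time.

    For the antipodes sA and sB, both rho o sA and sB o rho are left convolution
    inverses of rho.  They agree because the coproduct of a word w is w tensor 1
    plus terms whose left factor has smaller degree (NC_comul_lead), so that a
    linear map is determined by its convolution product with rho, by induction
    on the degree (rho_convolution_inj). *)

Set Implicit Arguments.
Unset Strict Implicit.
Unset Printing Implicit Defensive.

Import GRing.Theory.
Local Open Scope ring_scope.

(** * Finitely supported functions and their tensor products *)

Section LinearExtension.
Variables (K : choiceType) (M : lmodType rat).

Lemma linextEw (h : K -> M) (d : {fset K}) x : (msupp x `<=` d)%fset ->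
  linext h x = \sum_(k <- d) x@_k *: h k.
Proof.
move=> le; rewrite /linext (big_fset_incl _ le) //= => k _ /mcoeff_outdom ->.
by rewrite scale0r.
Qed.

Fact linext_is_linear (h : K -> M) : linear (linext h).
Proof.
move=> c x y; pose d := (msupp (c *: x + y) `|` (msupp x `|` msupp y))%fset.
have xd : (msupp x `<=` d)%fset by rewrite fsubsetU // fsubsetUl orbT.
have yd : (msupp y `<=` d)%fset by rewrite fsubsetU // fsubsetUr orbT.
rewrite (linextEw h (fsubsetUl _ _ : msupp _ `<=` d)%fset).
rewrite (linextEw h xd) (linextEw h yd).
rewrite scaler_sumr -big_split; apply: eq_bigr => k _.
by rewrite mcoeffD mcoeffZ scalerDl scalerA.
Qed.

HB.instance Definition _ (h : K -> M) :=
  GRing.isLinear.Build rat {malg rat[K]} M *:%R (linext h) (linext_is_linear h).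

Lemma linextU (h : K -> M) c k : linext h << c *g k >> = c *: h k.
Proof. by rewrite (linextEw h msuppU_le) big_seq_fset1 mcoeffUU. Qed.

Lemma linextU1 (h : K -> M) k : linext h << k >> = h k.
Proof. by rewrite linextU scale1r. Qed.

Lemma malgUZ c (k : K) : << c *g k >> = c *: << k >> :> {malg rat[K]}.
Proof. by apply/malgP => j; rewrite mcoeffZ !mcoeffU mulrnAr mulr1. Qed.

Lemma eq_linear_malg (f g : {malg rat[K]} -> M) :
  linear f -> linear g -> (forall k, f << k >> = g << k >>) -> f =1 g.
Proof.
have expand (h : {malg rat[K]} -> M) x : linear h ->
    h x = linext (fun k => h << k >>) x.
  move=> hl; pose h' : {linear _ -> _} :=
    HB.pack h (GRing.isLinear.Build _ _ _ _ h hl).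
  rewrite -[h]/(h' : _ -> _) {1}(monalgE x) linear_sum; apply: eq_bigr => k _.
  by rewrite malgUZ linearZ.
move=> fl gl fg x; rewrite (expand f) // (expand g) //.
by apply: eq_bigr => k _; rewrite fg.
Qed.

End LinearExtension.

Lemma linear_linext (K : choiceType) (M N : lmodType rat)
    (f : {linear M -> N}) (h : K -> M) x :
  f (linext h x) = linext (fun k => f (h k)) x.
Proof. by rewrite linear_sum; apply: eq_bigr => k _; rewrite linearZ. Qed.

(** The reason why the multiplicativity of a linear map can be checked on basis
    vectors. *)
Lemma eq_bilinear_malg (K L : choiceType) (M : lmodType rat)
    (b b' : {malg rat[K]} -> {malg rat[L]} -> M) :
    (forall y, linear (b^~ y)) -> (forall x, linear (b x)) ->
    (forall y, linear (b'^~ y)) -> (forall x, linear (b' x)) ->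
    (forall k l, b << k >> << l >> = b' << k >> << l >>) ->
  forall x y, b x y = b' x y.
Proof.
move=> bl br bl' br' bb x y.
apply: (@eq_linear_malg _ _ (b^~ y) (b'^~ y)) => // k.
exact: eq_linear_malg.
Qed.

Section Tensor.
Variables K L : choiceType.
Implicit Types (x : {malg rat[K]}) (y : {malg rat[L]}).

Lemma mcoeff_tens x y k l : (tens x y)@_(k, l) = x@_k * y@_l.
Proof.
have -> : tens x y = linext (fun i => linext (fun j => << (i, j) >>) y) x.
  apply: eq_bigr => i _; rewrite scaler_sumr; apply: eq_bigr => j _.
  by rewrite scalerA -malgUZ.
have sumE (I : choiceType) (z : {malg rat[I]}) i :
    \sum_(j <- msupp z) z@_j * (j == i)%:R = z@_i.
  rewrite {3}(monalgE z) raddf_sum /=; apply: eq_bigr => j _.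
  by rewrite /= mcoeffU mulr_natr.
rewrite /linext raddf_sum /= -[x@_k]sumE mulr_suml; apply: eq_bigr => i _.
rewrite mcoeffZ raddf_sum /= -mulrA -[y@_l]sumE mulr_sumr; congr (_ * _).
apply: eq_bigr => j _; rewrite mcoeffZ mcoeffU xpair_eqE.
by case: (i == k); case: (j == l); rewrite /= ?(mulr0, mul0r, mul1r).
Qed.

Lemma tens_linear_l (y : {malg rat[L]}) : linear ((@tens K L)^~ y).
Proof.
move=> c x x'; apply/malgP => -[k l].
by rewrite mcoeffD mcoeffZ !mcoeff_tens mcoeffD mcoeffZ mulrDl mulrA.
Qed.

Lemma tens_linear_r (x : {malg rat[K]}) : linear (@tens K L x).
Proof.
move=> c y y'; apply/malgP => -[k l].
by rewrite mcoeffD mcoeffZ !mcoeff_tens mcoeffD mcoeffZ mulrDr mulrCA.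
Qed.

Lemma tensUU (k : K) (l : L) : tens << k >> << l >> = << (k, l) >>.
Proof.
apply/malgP => -[i j]; rewrite mcoeff_tens !mcoeffU xpair_eqE.
by case: (k == i); case: (l == j); rewrite /= ?(mulr0, mul0r, mul1r).
Qed.

(** The universal property of the tensor product in terms of the bases. *)
Lemma linext_tens (M : lmodType rat) (b : {malg rat[K]} -> {malg rat[L]} -> M) :
    (forall y, linear (b^~ y)) -> (forall x, linear (b x)) ->
  forall x y, linext (fun p => b << p.1 >> << p.2 >>) (tens x y) = b x y.
Proof.
move=> bl br; apply: eq_bilinear_malg => // [y c x x'|x c y y'|k l].
- by rewrite tens_linear_l linearP.
- by rewrite tens_linear_r linearP.
by rewrite tensUU linextU1.
Qed.

End Tensor.

HB.instance Definition _ (K L K' L' : choiceType)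
    (f : {malg rat[K]} -> {malg rat[K']}) (g : {malg rat[L]} -> {malg rat[L']}) :=
  GRing.isLinear.Build rat {malg rat[(K * L)%type]}
    {malg rat[(K' * L')%type]} *:%R (tensmap f g) (linext_is_linear _).

Lemma tensmapU (K L K' L' : choiceType) (f : {malg rat[K]} -> {malg rat[K']})
    (g : {malg rat[L]} -> {malg rat[L']}) k l :
  tensmap f g << (k, l) >> = tens (f << k >>) (g << l >>).
Proof. exact: linextU1. Qed.

Lemma tensmap_tens (K L K' L' : choiceType)
    (f : {linear {malg rat[K]} -> {malg rat[K']}})
    (g : {linear {malg rat[L]} -> {malg rat[L']}}) x y :
  tensmap f g (tens x y) = tens (f x) (g y).
Proof.
apply: (linext_tens (b := fun x y => tens (f x) (g y))) => [z|z] c u v.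
  by rewrite linearP tens_linear_l.
by rewrite linearP tens_linear_r.
Qed.

Section MonoidAlgebra.
Variable M : monomType.
Implicit Types x y : {malg rat[M]}.

(** The product of a monoid algebra is also linear on the right, as scalars are
    central although the monoid need not be commutative. *)
Lemma malg_scalerAr c x y : x * (c *: y) = c *: (x * y).
Proof.
apply/malgP => k; rewrite mcoeffZ (mcoeffMlw k (fsubset_refl _) (msuppZ_le c y)).
rewrite mcoeffMl mulr_sumr; apply: eq_bigr => i _; rewrite mulr_sumr.
by apply: eq_bigr => j _; rewrite mcoeffZ mulrnAr mulrCA.
Qed.

Lemma malg_mul_linear_r x : linear (fun y => x * y).
Proof. by move=> c y z; rewrite mulrDr malg_scalerAr. Qed.

Lemma malg_mul_linear_l y : linear (fun x => x * y).
Proof. by move=> c x z; rewrite mulrDl scalerAl. Qed.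

Lemma malgUM (k l : M) : << k >> * << l >> = << mmul k l >> :> {malg rat[M]}.
Proof. by rewrite malgM_def fgmulUU mulr1. Qed.

End MonoidAlgebra.

(** * Induced subforests *)

Section Embeddings.
Variable S : Type.
Implicit Types F G : forest S.

(** Embeddings of parent structures as induced ones: [p' (e v)] may be a vertex
    outside the image, in which case [v] is a root. *)
Definition embedding (V W : finType) (p : V -> option V) (c : V -> S)
    (p' : W -> option W) (c' : W -> S) (e : V -> W) : Prop :=
  [/\ injective e, forall v w, p v = Some w <-> p' (e v) = Some (e w)
    & forall v, c' (e v) = c v].

Lemma embedding_comp (U V W : finType) p c p' c' p'' c''
    (e : U -> V) (e' : V -> W) :
  embedding p c p' c' e -> embedding p' c' p'' c'' e' ->
  embedding p c p'' c'' (e' \o e).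
Proof.
move=> [eI ep ec] [eI' ep' ec']; split; first exact: inj_comp.
  by move=> v w; rewrite ep ep'.
by move=> v /=; rewrite ec' ec.
Qed.

Lemma enum_rank_embedding (V : finType) p (c : V -> S) (acp : acyclic p) :
  embedding p c (@parent _ (mkforest c acp)) (@color _ (mkforest c acp))
    (@enum_rank V).
Proof.
split=> [|v w|v]; first exact: enum_rank_inj.
  rewrite /= /mk_parent enum_rankK; split=> [->//|].
  by case: (p v) => //= x [/enum_rank_inj ->].
by rewrite /= enum_rankK.
Qed.

Lemma enum_val_embedding (V : finType) p (c : V -> S) (acp : acyclic p) :
  embedding (@parent _ (mkforest c acp)) (@color _ (mkforest c acp)) p c
    (@enum_val V predT).
Proof.
split=> // [|v w]; first exact: enum_val_inj.
rewrite /= /mk_parent; split=> [|->]; last by rewrite /= enum_valK.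
by case: (p _) => //= x [<-]; rewrite enum_rankK.
Qed.

Definition forest_embedding F G (e : vert F -> vert G) : Prop :=
  embedding (@parent _ F) (@color _ F) (@parent _ G) (@color _ G) e.

Lemma forest_iso_embedding F G : forest_iso F G ->
  exists2 e : vert F -> vert G, forest_embedding e & e @: setT = setT.
Proof.
move=> [e [[g gK eK] ep ec]]; have eI := can_inj gK.
exists e; last by apply/setP => x; rewrite inE -(eK x) imset_f ?inE.
split=> // v w; rewrite ep; split=> [->//|].
by case: (parent v) => //= x [/eI ->].
Qed.

(** An induced subforest is determined by its vertex set.  All isomorphisms
    between iterated restrictions, representatives and unions reduce to this
    lemma, by exhibiting both sides as embeddings with one image. *)
Lemma embedding_same_image F1 F2 G (e1 : vert F1 -> vert G)
    (e2 : vert F2 -> vert G) :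
  forest_embedding e1 -> forest_embedding e2 ->
  e1 @: setT = e2 @: setT -> forest_iso F1 F2.
Proof.
have lift G1 G2 (f1 : vert G1 -> vert G) (f2 : vert G2 -> vert G) :
    f1 @: setT = f2 @: setT -> exists f, forall v, f1 v = f2 (f v).
  move=> imf; suff /choice [f fE] : forall v, exists w, f1 v = f2 w by exists f.
  move=> v; have : f1 v \in f1 @: setT by rewrite imset_f.
  by rewrite imf => /imsetP [w _ ->]; exists w.
move=> [I1 p1 c1] [I2 p2 c2] im12.
have [f fE] := lift _ _ _ _ im12; have [g gE] := lift _ _ _ _ (esym im12).
have gfK : cancel f g by move=> v; apply: I1; rewrite -gE -fE.
have fgK : cancel g f by move=> v; apply: I2; rewrite -fE -gE.
exists f; split; first by exists g.
  move=> v; case pv: (parent v) => [w|] /=.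
    by apply/p2; rewrite -!fE; apply/p1.
  case pfv: (parent (f v)) => [w|] //.
  by have := (p2 _ _).1 pfv; rewrite -fE -[w]fgK -fE => /p1; rewrite pv.
by move=> v; rewrite -c2 -fE c1.
Qed.

Section Restriction.
Variables (F : forest S).

Definition restr_class (U : {set vert F}) : Iso S := iso_class (part finset.set0 U).

(** The edges of a cut join the pruned part to the rest, so they are already lost
    on restricting to either part. *)
Lemma part_embedding (E U : {set vert F}) :
    (forall v w, v \in E -> v \in U -> w \in U -> parent v <> Some w) ->
  exists2 e : vert (part E U) -> vert F, forest_embedding e & e @: setT = U.
Proof.
move=> EU; exists (val \o @enum_val _ predT); last first.
  apply/setP => x; apply/imsetP/idP => [[v _ ->]|xU]; first exact: valP.
  by exists (enum_rank (exist (fun v => v \in U) x xU)); rewrite ?inE //= enum_rankK.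
apply: embedding_comp; first exact: enum_val_embedding.
split=> // [|v w]; first exact: val_inj.
rewrite /part_parent; case: ifP => [vE|_].
  by split=> // /(EU _ _ vE (valP v) (valP w)).
case: (parent _) => //= x; split=> [|[->]]; last by rewrite valK.
by case: insubP => //= y _ <- [->].
Qed.

Lemma restr_class_eq G (e : vert G -> vert F) U :
  forest_embedding e -> e @: setT = U -> iso_class G = restr_class U.
Proof.
move=> emb imU; apply/iso_classP.
have [|e' emb' imU'] := @part_embedding finset.set0 U; first by move=> v w; rewrite inE.
by apply: (embedding_same_image emb emb'); rewrite imU imU'.
Qed.

Lemma restr_classT : restr_class setT = iso_class F.
Proof.
apply/esym/(@restr_class_eq _ id); last by apply/setP => x; rewrite imset_id.
by split.
Qed.

Lemma restr_class_part (E U : {set vert F}) :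
  (forall v w, v \in E -> v \in U -> w \in U -> parent v <> Some w) ->
  iso_class (part E U) = restr_class U.
Proof. by move=> /part_embedding [e emb im]; apply: restr_class_eq emb im. Qed.

End Restriction.

Lemma restr_class_embedding F G (e : vert G -> vert F) U :
  forest_embedding e -> restr_class U = restr_class (e @: U).
Proof.
move=> emb; have [|e' emb' im'] := @part_embedding G finset.set0 U.
  by move=> v w; rewrite inE.
by apply: (restr_class_eq (embedding_comp emb' emb)); rewrite imset_comp im'.
Qed.

(** The product is computed on the chosen representative of a class; this is the
    way back to the forest the class came from. *)
Lemma restr_class_cover F (U : {set vert F}) :
  exists2 e : vert (representative (restr_class U)) -> vert F,
    forest_embedding e & e @: setT = U.
Proof.
have [|e emb im] := @part_embedding F finset.set0 U.
  by move=> v w; rewrite inE.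
have [e' emb' im'] := forest_iso_embedding (representative_iso (part finset.set0 U)).
by exists (e \o e'); [exact: embedding_comp emb|rewrite imset_comp im' im].
Qed.

End Embeddings.

(** * Admissible cuts as child-closed sets of vertices *)

Section Cuts.
Variable S : Type.
Implicit Types F G : forest S.

(** Inside [W], the set [U] contains the children of its vertices; for [W] the
    whole forest these are the pruned sets of admissible cuts. *)
Definition closed_in F (W U : {set vert F}) : bool :=
  (U \subset W) && [forall v in W, forall w in U, (parent v == Some w) ==> (v \in U)].

Lemma closed_inP F (W U : {set vert F}) :
  reflect (U \subset W /\
      forall v w, v \in W -> w \in U -> parent v = Some w -> v \in U)
    (closed_in W U).
Proof.
apply: (iffP andP) => -[UW clU]; split=> //.
  move=> v w vW wU vw; move: clU => /forall_inP /(_ v vW) /forall_inP /(_ w wU).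
  by rewrite vw eqxx.
apply/forall_inP => v vW; apply/forall_inP => w wU; apply/implyP => /eqP.
exact: clU.
Qed.

Section TopCut.
Variable F : forest S.
Implicit Types (U : {set vert F}) (C : cut F).

Let anc := @ancestor (vert F) (@parent _ F).

(** The cut just above the topmost vertices of [U], with the roots in [U] recorded
    as full cuts and the others by the edge to their parent. *)
Definition top_cut U : cut F :=
  ([set v in U | parent v == None],
   [set v in U | if parent v is Some w then w \notin U else false]).

Lemma closed_ancestor U u v :
  closed_in setT U -> u \in U -> anc u v -> v \in U.
Proof.
move=> /closed_inP [_ clU] uU /connectP [s]; elim: s v => [|w s IHs] v /=.
  by move=> _ <-.
by move=> /andP [/eqP vw ws] uE; apply: (clU v w) => //; apply: IHs.
Qed.

Lemma ancestor_step u v : anc u v -> u = v \/ exists2 w, parent v = Some w & anc u w.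
Proof.
move=> /connectP [[|w s] /=]; first by left.
move=> /andP [/eqP vw ws] uE; right; exists w => //; apply/connectP.
by exists s.
Qed.

Lemma ancestor_parent v w : parent v = Some w -> ~~ anc v w.
Proof.
move=> vw; have /forallP /(_ v) /forallP /(_ w) := @acyclic_parent _ F.
by move=> /implyP; apply; apply/eqP.
Qed.

(** Above a topmost vertex of [U] there is no vertex of [U], since a closed set
    would then also contain its parent. *)
Lemma top_cut_top U u v : closed_in setT U ->
  u \in U -> v \in (top_cut U).1 :|: (top_cut U).2 -> anc u v -> u = v.
Proof.
move=> clU uU vC /ancestor_step [//|[w vw uw]].
have := closed_ancestor clU uU uw.
by move: vC; rewrite !inE vw; case/orP => /andP [_ ] // /negbTE ->.
Qed.

Lemma pruned_top_cut U : closed_in setT U -> pruned_set (top_cut U) = U.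
Proof.
move=> clU; apply/setP => v; rewrite inE; apply/exists_inP/idP.
  move=> [u uC uv]; apply: closed_ancestor uv => //.
  by move: uC; rewrite !inE => /orP [] /andP [].
have [h hp] := acyclicP (@acyclic_parent _ F).
have [n] := ubnP (h v); elim: n v => // n IHn v hv vU.
case vw: (parent v) => [w|]; last first.
  by exists v; rewrite ?inE ?vU ?vw //; apply: connect0.
have [wU|wU] := boolP (w \in U); last first.
  by exists v; [rewrite !inE vU vw wU orbT|apply: connect0].
have [u uC uw] := IHn w (leq_trans (hp _ _ vw) hv) wU.
by exists u => //; apply: connect_trans uw; apply/connect1/eqP.
Qed.

(** A leaf has at most one edge of the cut above it: the ancestors of a leaf form a
    chain, and two comparable topmost vertices coincide. *)
Lemma top_cut_admissible U : closed_in setT U -> admissible (top_cut U).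
Proof.
move=> clU; apply/and4P; split.
- by apply/subsetP => v; rewrite !inE => /andP [].
- by apply/subsetP => v; rewrite !inE; case: (parent v); rewrite ?andbF.
- apply/forall_inP => r rC; apply/forall_inP => v vC; apply/negP => rv.
  have rU : r \in U by move: rC; rewrite inE => /andP [].
  have rE : r = v by apply: top_cut_top clU rU _ rv; rewrite in_setU vC orbT.
  by move: rC vC; rewrite rE !inE => /andP [_ /eqP ->]; rewrite andbF.
apply/forall_inP => l _; apply/card_le1_eqP => u v.
rewrite [u \in _]inE [v \in _]inE => /andP [uC ul] /andP [vC vl].
have top x : x \in (top_cut U).2 -> x \in U /\ x \in (top_cut U).1 :|: (top_cut U).2.
  by move=> xC; rewrite in_setU xC orbT; move: xC; rewrite inE => /andP [].
have [uU {}uC] := top u uC; have [vU {}vC] := top v vC.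
case/connectP: ul vl => s; elim: s l => [|w s IHs] l /=.
  by move=> _ <- vu; apply: (top_cut_top clU vU uC vu).
move=> /andP [/eqP lw ws] uE /ancestor_step [vE|[w' lw' vw']].
  apply/esym/(top_cut_top clU uU vC); rewrite vE; apply/connectP.
  by exists (w :: s) => //=; apply/andP; split=> //; apply/eqP.
by move: lw'; rewrite lw => -[wE]; apply: (IHs w) => //; rewrite wE.
Qed.

Lemma leaf_below v : exists2 l, l \in forest_leaves F & anc v l.
Proof.
have [h hp] := acyclicP (@acyclic_parent _ F).
case: (@arg_maxnP _ v (anc v) h (connect0 _ _)) => l vl lmax; exists l => //.
rewrite inE; apply/forallP => w; apply/eqP => wl.
have hwl : (h w <= h l)%N.
  by apply: lmax; apply: connect_trans vl; apply/connect1/eqP.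
by rewrite leqNgt hp in hwl.
Qed.

(** The cut is recovered from its pruned set.  The point is that the parent of a
    cut edge's lower end is never pruned: otherwise the edge would lie in a fully
    cut tree, or some leaf below it would have two edges of the cut on its path
    to the root. *)
Lemma top_cut_pruned C : admissible C -> top_cut (pruned_set C) = C.
Proof.
case: C => R E /and4P [/= /subsetP Rr /subsetP Er RE leafE].
have rootsP v : v \in R -> parent v = None by move=> /Rr; rewrite inE => /eqP.
have edgesP v : v \in E -> exists w, parent v = Some w.
  by move=> /Er; rewrite !inE; case: (parent v) => // w _; exists w.
have prunedP v : v \in pruned_set (R, E) -> v \in R :|: E \/
    exists w, parent v = Some w /\ w \in pruned_set (R, E).
  rewrite [v \in _]inE => /exists_inP [u uC /ancestor_step [<-|[w vw uw]]].
    by left.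
  by right; exists w; split=> //; rewrite inE; apply/exists_inP; exists u.
have CU v : v \in R :|: E -> v \in pruned_set (R, E).
  by move=> vC; rewrite inE; apply/exists_inP; exists v => //; apply: connect0.
congr (_, _); apply/setP => v; rewrite inE; apply/andP/idP.
- move=> [/prunedP [/setUP [//|/edgesP [w ->]]|[w [-> _]]]] //.
- by move=> vR; rewrite (rootsP v) ?CU // inE vR.
- move=> [/prunedP [/setUP [/rootsP ->|//]|[w [-> wU]]]] //.
  by rewrite wU.
move=> vE; have [w vw] := edgesP v vE; rewrite CU ?vw; last by rewrite inE vE orbT.
split=> //; rewrite [w \in _]inE; apply/negP => /exists_inP [u /setUP [] uC uw].
  move: RE => /forall_inP /(_ u uC) /forall_inP /(_ v vE) /negP; apply.
  by apply: connect_trans uw; apply/connect1/eqP.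
have [l l0 vl] := leaf_below v.
have ul : anc u l.
  by apply: connect_trans vl (connect_trans _ uw); apply/connect1/eqP.
have /forall_inP /(_ l l0) /card_le1_eqP uv := leafE.
have /uv : u \in [set x in E | ancestor (@parent _ F) x l] by rewrite inE uC.
have {uv} /[swap] /[apply] : v \in [set x in E | ancestor (@parent _ F) x l].
  by rewrite inE vE.
by move=> uE; have := ancestor_parent vw; rewrite /anc uE uw.
Qed.

Lemma pruned_set_closed C : closed_in setT (pruned_set C).
Proof.
apply/closed_inP; split=> [|v w _]; first exact: subsetT.
rewrite inE => /exists_inP [u uC uw] vw; rewrite inE; apply/exists_inP.
by exists u => //; apply: connect_trans uw; apply/connect1/eqP.
Qed.

Lemma iso_class_cutP U : closed_in setT U ->
  iso_class (cutP (top_cut U)) = restr_class U.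
Proof.
move=> clU; rewrite /cutP pruned_top_cut //; apply: restr_class_part => v w.
by rewrite inE => /andP [_ vC] _ wU vw; rewrite vw wU in vC.
Qed.

Lemma iso_class_cutR U : closed_in setT U ->
  iso_class (cutR (top_cut U)) = restr_class (~: U).
Proof.
move=> clU; rewrite /cutR pruned_top_cut //; apply: restr_class_part => v w.
by rewrite !inE => /andP [-> _].
Qed.

End TopCut.
End Cuts.

(** * The product of the Hall algebra *)

Section Hall.
Variable S : Type.
Implicit Types (F G : forest S) (f g h : hall S).

(** Being closed only involves edges with both ends in [W], hence it can be tested
    in any forest into which the subforest embeds. *)
Lemma closed_embedding F G (e : vert G -> vert F) (W U : {set vert G}) :
  forest_embedding e -> closed_in (e @: W) (e @: U) = closed_in W U.
Proof.
move=> [eI ep _]; apply/closed_inP/closed_inP => -[UW clU]; split.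
- by apply/subsetP => v vU; rewrite -(mem_imset W v eI) (subsetP UW) ?imset_f.
- move=> v w vW wU vw; rewrite -(mem_imset U v eI).
  by apply: (clU _ (e w)); rewrite ?imset_f //; apply/ep.
- exact: imsetS.
- move=> _ _ /imsetP [v vW ->] /imsetP [w wU ->] /ep vw.
  by rewrite imset_f // (clU v w).
Qed.

Lemma hall_mul_closed f g M : (hall_mul f g)@_M =
  \sum_(T : {set vert (representative M)} | closed_in setT T)
    f@_(restr_class T) * g@_(restr_class (~: T)).
Proof.
rewrite hall_mulE (reindex_onto (@top_cut _ _) (@pruned_set _ _)) /=; last first.
  by move=> C /top_cut_pruned.
apply: eq_big => [T|T /andP [_ /eqP <-]].
  apply/andP/idP => [[_ /eqP <-]|clT]; first exact: pruned_set_closed.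
  by rewrite top_cut_admissible ?pruned_top_cut.
by rewrite iso_class_cutP ?iso_class_cutR //; apply: pruned_set_closed.
Qed.

(** The form of the product used from here on: all the subforests that occur are
    restrictions of one fixed forest, so no isomorphism has to be carried along. *)
Lemma hall_mul_restr f g F (W : {set vert F}) : (hall_mul f g)@_(restr_class W) =
  \sum_(U : {set vert F} | closed_in W U)
    f@_(restr_class U) * g@_(restr_class (W :\: U)).
Proof.
rewrite hall_mul_closed; have [e emb eW] := restr_class_cover W; have [eI _ _] := emb.
rewrite [RHS](reindex_onto (fun T : {set _} => e @: T)
  (fun U : {set _} => e @^-1: U)) /=; last first.
  move=> U /closed_inP [UW _]; apply/setP => x.
  apply/imsetP/idP => [[v + ->]|xU]; first by rewrite inE.
  have /imsetP [v _ xE] : x \in e @: setT by rewrite eW (subsetP UW).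
  by exists v; rewrite // inE -xE.
apply: eq_big => [T|T _].
  have -> : closed_in W (e @: T) = closed_in setT T.
    by rewrite -(closed_embedding _ _ emb) eW.
  by rewrite andb_idr // => _; apply/eqP/setP => v; rewrite inE mem_imset.
rewrite !(restr_class_embedding _ emb); congr (_ * mcoeff (restr_class _) _).
apply/setP => x; have xW : (x \in W) = (x \in e @: setT) by rewrite eW.
rewrite in_setD xW.
apply/imsetP/andP => [[v vT ->]|[xT /imsetP [v _ xE]]].
  by split; rewrite mem_imset ?inE // -in_setC.
by exists v => //; move: xT; rewrite xE mem_imset // inE.
Qed.

(** Both sides sum over the pairs T <= U with U closed in the forest and T closed
    in U; the left side lists them as T closed in the forest and U \ T closed in
    the complement of T. *)
Lemma hall_mulA : associative (@hall_mul S).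
Proof.
move=> f g h; apply/malgP => M; rewrite -(representativeK M) -restr_classT !hall_mul_restr.
set F := representative M.
under eq_bigr do rewrite hall_mul_restr mulr_sumr.
under [RHS]eq_bigr do rewrite hall_mul_restr mulr_suml.
rewrite pair_big_dep [RHS]pair_big_dep /=.
pose diff (p : {set vert F} * {set vert F}) := (p.2, p.1 :\: p.2).
pose union (p : {set vert F} * {set vert F}) := (p.1 :|: p.2, p.1).
have unionK (U T : {set vert F}) : T \subset U -> union (diff (U, T)) = (U, T).
  move=> /setIidPr TU; rewrite /union /diff /=; congr (_, _).
  by rewrite -{1}TU setID.
(* T and its complement in U name the pair on the left, U and T on the right. *)
rewrite (reindex_onto diff union) /=; last first.
  move=> [T U] /= /andP [_ /closed_inP [/subsetDP [_ dUT] _]].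
  by rewrite /diff /= setDUl setDv set0U; congr (_, _); apply/setDidPl.
apply: eq_big => [[U T] /=|[U T] /= /andP [_ /eqP [UE]]]; last first.
  by rewrite -mulrA setDDl UE.
apply/andP/andP => [[/andP [/closed_inP [_ clT] /closed_inP [_ clU]] /eqP [UE]]|].
  have TU : T \subset U by rewrite -UE subsetUl.
  split; apply/closed_inP; split=> // v w vV wU vw.
    have [vT|vT] := boolP (v \in T); first exact: (subsetP TU).
    have [wT|wT] := boolP (w \in T); first by rewrite (clT _ w) in vT.
    by have := clU v w; rewrite !inE vT wT wU => /(_ isT isT vw).
  exact: clT vw.
move=> [/closed_inP [_ clU] /closed_inP [TU clT]]; rewrite unionK // eqxx.
split=> //; apply/andP; split; apply/closed_inP; split.
- exact: subsetT.
- move=> v w _ wT vw; apply: (clT v w) => //.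
  by apply: (clU v w) => //; apply: (subsetP TU).
- by apply: setSD; apply: subsetT.
- move=> v w; rewrite !inE !andbT => vT /andP [_ wU] vw.
  by rewrite vT; apply: (clU v w).
Qed.

Lemma iso_class_empty F :
  (iso_class F == iso_class (empty_forest S)) = (nb_vertices F == 0).
Proof.
apply/eqP/eqP => [/iso_classP [e [eb _ _]]|F0].
  by have := bij_eq_card eb; rewrite !card_ord /= card_void.
by apply/iso_classP/forest_iso0; rewrite //= card_void.
Qed.

Lemma restr_class_eq_empty F (U : {set vert F}) :
  (restr_class U == iso_class (empty_forest S)) = (U == set0).
Proof.
rewrite iso_class_empty /= -cards_eq0; congr (_ == 0)%N.
exact: card_sig (mem U).
Qed.

Lemma mcoeff_hall_one A : (hall_one S)@_A = (A == iso_class (empty_forest S))%:R.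
Proof. by rewrite mcoeffU eq_sym. Qed.

Lemma hall_oneE F (U : {set vert F}) : (hall_one S)@_(restr_class U) = (U == set0)%:R.
Proof. by rewrite mcoeff_hall_one restr_class_eq_empty. Qed.

Lemma hall_mul1l : left_id (hall_one S) (@hall_mul S).
Proof.
move=> f; apply/malgP => M; rewrite -(representativeK M) -restr_classT hall_mul_restr.
rewrite (bigD1 set0) /=; last first.
  apply/closed_inP; split; first exact: sub0set.
  by move=> v w _; rewrite inE.
rewrite hall_oneE eqxx mul1r setD0 big1 ?addr0 // => U /andP [_ /negbTE U0].
by rewrite hall_oneE U0 mul0r.
Qed.

Lemma hall_mulr1 : right_id (hall_one S) (@hall_mul S).
Proof.
move=> f; apply/malgP => M; rewrite -(representativeK M) -restr_classT hall_mul_restr.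
rewrite (bigD1 setT) /=; last by apply/closed_inP; split=> [|v w _ _ _]; rewrite ?inE.
rewrite hall_oneE setDv eqxx mulr1 big1 ?addr0 // => U /andP [_ /negbTE UT].
by rewrite hall_oneE setTD -setCT (inj_eq (@setC_inj _)) UT mulr0.
Qed.

Lemma hall_mul_linear_r f : linear (hall_mul f).
Proof.
move=> c x y; apply/malgP => M.
rewrite mcoeffD mcoeffZ !hall_mul_closed mulr_sumr -big_split; apply: eq_bigr => U _.
by rewrite mcoeffD mcoeffZ mulrDr mulrCA.
Qed.

Lemma hall_mul_linear_l g : linear ((@hall_mul S)^~ g).
Proof.
move=> c x y; apply/malgP => M.
rewrite mcoeffD mcoeffZ !hall_mul_closed mulr_sumr -big_split; apply: eq_bigr => U _.
by rewrite mcoeffD mcoeffZ mulrDl mulrA.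
Qed.

(** The empty set is the only closed set of the empty forest. *)
Lemma hall_counitM f g : hall_counit (hall_mul f g) = hall_counit f * hall_counit g.
Proof.
pose F := representative (iso_class (empty_forest S)).
have FE : restr_class (finset.set0 : {set vert F}) = iso_class (empty_forest S).
  by apply/eqP; rewrite restr_class_eq_empty.
rewrite /hall_counit -FE hall_mul_restr (big_pred1 set0) ?setD0 // => U /=.
apply/closed_inP/eqP => [[]|->]; first by rewrite subset0 => /eqP.
by split=> // v w; rewrite inE.
Qed.

Section UnionEmbedding.
Variables F G : forest S.

Let inF (v : vert F) : vert (union_forest F G) :=
  enum_rank (inl v : vert F + vert G).
Let inG (v : vert G) : vert (union_forest F G) :=
  enum_rank (inr v : vert F + vert G).

Definition union_set (U : {set vert F}) (V : {set vert G}) :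
  {set vert (union_forest F G)} := inF @: U :|: inG @: V.

Let mem_union_setF U V v : (inF v \in union_set U V) = (v \in U).
Proof.
rewrite in_setU mem_imset; last by move=> x y /enum_rank_inj [].
by case: imsetP => [[w _ /enum_rank_inj //]|_]; rewrite orbF.
Qed.

Let mem_union_setG U V v : (inG v \in union_set U V) = (v \in V).
Proof.
rewrite in_setU orbC mem_imset; last by move=> x y /enum_rank_inj [].
by case: imsetP => [[w _ /enum_rank_inj //]|_]; rewrite orbF.
Qed.

Let unionP x : (exists v, x = inF v) \/ (exists v, x = inG v).
Proof.
by rewrite -(enum_valK x); case: (enum_val x) => v; [left|right]; exists v.
Qed.

Lemma union_setC U V : union_set (~: U) (~: V) = ~: union_set U V.
Proof.
apply/setP => x; rewrite [RHS]in_setC; have [[v ->]|[v ->]] := unionP x.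
  by rewrite !mem_union_setF inE.
by rewrite !mem_union_setG inE.
Qed.

(** The restrictions of the summands and of the union embed in the union with the
    same image. *)
Lemma restr_class_union U V :
  restr_class (union_set U V) = oplus (restr_class U) (restr_class V).
Proof.
have [e [eI ep ec] eU] := restr_class_cover U.
have [e' [eI' ep' ec'] eV] := restr_class_cover V.
pose k x := match x with inl v => inl (e v) | inr v => inr (e' v) end.
have kemb : embedding (@union_parent S _ _) (@union_color S _ _)
    (@union_parent S F G) (@union_color S F G) k.
  split; last by move=> [v|v] /=; rewrite ?ec ?ec'.
    by move=> [v|v] [w|w] //= [] => [/eI|/eI'] ->.
  move=> [v|v] [w|w] /=.
  - split=> [|]; first by case pv: (parent v) => //= -[<-]; rewrite (iffLR (ep _ _) pv).
    by case pv: (parent (e v)) => //= -[pE]; rewrite (iffRL (ep v w)) // pv pE.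
  - by case: (parent v) => //; case: (parent (e v)).
  - by case: (parent v) => //; case: (parent (e' v)).
  split=> [|]; first by case pv: (parent v) => //= -[<-]; rewrite (iffLR (ep' _ _) pv).
  by case pv: (parent (e' v)) => //= -[pE]; rewrite (iffRL (ep' v w)) // pv pE.
have emb := embedding_comp (enum_val_embedding _ (acyclic_union _ _))
  (embedding_comp kemb (enum_rank_embedding _ (acyclic_union _ _))).
apply/esym/(restr_class_eq emb); apply/setP => x; apply/imsetP/idP.
  move=> [y _ ->] /=; case: (enum_val y) => v /=.
    by have := imset_f e (in_setT v); rewrite mem_union_setF eU.
  by have := imset_f e' (in_setT v); rewrite mem_union_setG eV.
have [[v ->]|[v ->]] := unionP x.
  rewrite mem_union_setF => vU; have /imsetP [w _ ->] : v \in e @: setT by rewrite eU.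
  by exists (enum_rank (inl w)); rewrite ?inE //= enum_rankK.
rewrite mem_union_setG => vV; have /imsetP [w _ ->] : v \in e' @: setT by rewrite eV.
by exists (enum_rank (inr w)); rewrite ?inE //= enum_rankK.
Qed.

(** No edge of a disjoint union joins the two summands. *)
Lemma closed_union_set U V :
  closed_in setT (union_set U V) = closed_in setT U && closed_in setT V.
Proof.
have pF v : parent (inF v) = omap inF (parent v).
  by rewrite /= /mk_parent enum_rankK /=; case: (parent v).
have pG v : parent (inG v) = omap inG (parent v).
  by rewrite /= /mk_parent enum_rankK /=; case: (parent v).
apply/closed_inP/andP.
  move=> [_ clUV]; split; apply/closed_inP; split=> // v w _ wU vw.
    by rewrite -(mem_union_setF U V); apply: (clUV _ (inF w));
      rewrite ?mem_union_setF ?pF ?vw.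
  by rewrite -(mem_union_setG U V); apply: (clUV _ (inG w));
      rewrite ?mem_union_setG ?pG ?vw.
move=> [/closed_inP [_ clU] /closed_inP [_ clV]]; split=> // x y _.
have [[v ->]|[v ->]] := unionP x; rewrite ?pF ?pG ?mem_union_setF ?mem_union_setG.
  case vw: (parent v) => [w|] //= yUV [yE]; move: yUV.
  by rewrite -yE mem_union_setF => /clU /(_ vw); apply.
case vw: (parent v) => [w|] //= yUV [yE]; move: yUV.
by rewrite -yE mem_union_setG => /clV /(_ vw); apply.
Qed.

(** What makes the coproduct multiplicative: cutting a disjoint union is cutting
    each summand. *)
Lemma hall_mul_union f g :
  (hall_mul f g)@_(iso_class (union_forest F G)) =
  \sum_(U : {set vert F} | closed_in setT U)
  \sum_(V : {set vert G} | closed_in setT V)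
    f@_(oplus (restr_class U) (restr_class V)) *
    g@_(oplus (restr_class (~: U)) (restr_class (~: V))).
Proof.
pose fromF (W : {set vert (union_forest F G)}) : {set vert F} := inF @^-1: W.
pose fromG (W : {set vert (union_forest F G)}) : {set vert G} := inG @^-1: W.
rewrite -restr_classT hall_mul_restr pair_big /=.
rewrite (reindex_onto (fun p : {set vert F} * {set vert G} => union_set p.1 p.2)
  (fun W => (fromF W, fromG W))) /=; last first.
  move=> W _; apply/setP => x.
  by have [[v ->]|[v ->]] := unionP x; rewrite ?mem_union_setF ?mem_union_setG inE.
apply: eq_big => [[U V]|[U V] _] /=; last first.
  by rewrite setTD -union_setC !restr_class_union.
rewrite closed_union_set andb_idr // => _; apply/eqP; congr (_, _); apply/setP => v.
  by rewrite inE mem_union_setF.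
by rewrite inE mem_union_setG.
Qed.

End UnionEmbedding.

Lemma hall_mul_oplus f g A B : (hall_mul f g)@_(oplus A B) =
  \sum_(U : {set vert (representative A)} | closed_in setT U)
  \sum_(V : {set vert (representative B)} | closed_in setT V)
    f@_(oplus (restr_class U) (restr_class V)) *
    g@_(oplus (restr_class (~: U)) (restr_class (~: V))).
Proof. exact: hall_mul_union. Qed.

End Hall.

(** * Effective classes and their degree *)

Section ClassGroup.
Variable S : Type.
Implicit Types F : forest S.

(** The defining relation of the Grothendieck group, read on closed sets. *)
Lemma K0_class_closed F (U : {set vert F}) : closed_in setT U ->
  K0_class (iso_class F) = K0_class (restr_class U) + K0_class (restr_class (~: U)).
Proof.
move=> clU; rewrite -iso_class_cutP // -iso_class_cutR //.
rewrite /K0_class -raddfD; apply/eqP; rewrite -Quotient.idealrBE.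
by apply/asboolP => N _; apply; apply: top_cut_admissible.
Qed.

Lemma restr_class1 F (v : vert F) :
  restr_class [set v] = iso_class (vertex_forest (color v)).
Proof.
have I1 (x y : vert (vertex_forest (color v))) : x = y.
  by apply: enum_val_inj; case: (enum_val x); case: (enum_val y).
apply/esym/(@restr_class_eq _ _ _ (fun=> v)).
  split=> // x y.
  by split=> // vv; have := ancestor_parent vv; rewrite /ancestor connect0.
apply/setP => x; rewrite inE; apply/imsetP/eqP => [[]//|->].
by exists (enum_rank tt).
Qed.

(** Vertex counts factor through the Grothendieck group, so that only the empty
    forest has class 0. *)
Lemma K0_class_eq0 (A : Iso S) :
  (K0_class A == 0) = (A == iso_class (empty_forest S)).
Proof.
apply/eqP/eqP => [|->]; last exact: K0_class_empty.
rewrite -K0_class_empty => /(K0_class_nb_vert predT).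
rewrite nb_vert_repr /nb_vert !sum1_card !card_ord /= card_void => A0.
by apply/eqP; rewrite -(representativeK A) iso_class_empty A0.
Qed.

(** A deepest vertex has no children, hence is closed by itself; splitting it off
    removes one basis element from the class. *)
Lemma K0_class_effective (A : Iso S) : K0_class A \in @effective S.
Proof.
suff [l lE] : exists l, K0_class A = \sum_(s <- l) K0_basis s.
  by apply/asboolP; exists l, (fun=> 1%N).
rewrite -(representativeK A); move: (representative A) => F {A}.
have [n] := ubnP (nb_vertices F); elim: n F => // n IHn F Fn.
have [F0|F0] := posnP (nb_vertices F).
  exists [::]; rewrite big_nil; apply/eqP.
  by rewrite K0_class_eq0 iso_class_empty F0.
pose v0 : vert F := Ordinal F0.
have [h hp] := acyclicP (@acyclic_parent _ F).
case: (@arg_maxnP _ v0 predT h isT) => v _ vmax.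
have [|l lE] := IHn (part finset.set0 (~: [set v])).
  have -> : nb_vertices (part finset.set0 (~: [set v])) = #|~: [set v]|.
    exact: card_sig (mem (~: [set v])).
  by rewrite cardsCs setCK cards1 card_ord subn1 prednK.
exists (color v :: l); rewrite big_cons -lE (@K0_class_closed _ [set v]) ?restr_class1 //.
apply/closed_inP; split=> // w x _ /set1P -> /hp hvw.
have hwv : (h w <= h v)%N by apply: vmax.
by rewrite leqNgt hvw in hwv.
Qed.
(** The number of vertices of any forest of class [a]. *)
Definition degree (a : K0plus S) : nat :=
  nb_vert predT (representative (sval (cid (effectiveP (valP a))))).

Lemma degreeE (a : K0plus S) A :
  val a = K0_class A -> degree a = nb_vert predT (representative A).
Proof.
rewrite /degree; case: (cid _) => B /= aB aA.
by apply: K0_class_nb_vert; rewrite -aA -aB.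
Qed.

Lemma degreeD (a b c : K0plus S) :
  val a + val b = val c -> degree c = (degree a + degree b)%N.
Proof.
have [A aA] := effectiveP (valP a); have [B bB] := effectiveP (valP b).
rewrite {1}aA {1}bB -K0_class_oplus => /esym cC.
by rewrite (degreeE aA) (degreeE bB) (degreeE cC) nb_vert_oplus.
Qed.

Lemma degree_gt0 (a : K0plus S) : val a != 0 -> (0 < degree a)%N.
Proof.
have [A aA] := effectiveP (valP a); rewrite (degreeE aA) aA; apply: contraNT.
rewrite -eqn0Ngt => A0; rewrite K0_class_eq0 -[A]representativeK iso_class_empty.
by move: A0; rewrite /nb_vert sum1_card card_ord.
Qed.

End ClassGroup.

(** * The algebra homomorphism *)

Section Rho.
Variable S : Type.
Implicit Types (f g h : hall S).

Lemma kappa0 (a : K0plus S) : val a = 0 -> kappa a = hall_one S.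
Proof.
move=> a0; apply/malgP => A; rewrite kappaE a0 K0_class_eq0 mcoeffU eq_sym.
by case: eqP.
Qed.

Definition rho_word (w : word S) : hall S :=
  foldr (fun (g : generator S) h => hall_mul (kappa (val g)) h) (hall_one S)
    (fmonom_val w).

Definition rho : {linear NC S -> hall S} := linext rho_word.

Lemma rhoU w : rho << w >> = rho_word w.
Proof. exact: linextU1. Qed.

Lemma rho_word1 : rho_word mone = hall_one S.
Proof. by rewrite /rho_word fm1. Qed.

Lemma rho1 : rho 1 = hall_one S.
Proof. by rewrite -rho_word1 -rhoU. Qed.

Lemma rho_wordM w w' : rho_word (mmul w w') = hall_mul (rho_word w) (rho_word w').
Proof.
rewrite /rho_word fmM; elim: (fmonom_val w) => [|g s IHs] /=.
  by rewrite hall_mul1l.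
by rewrite IHs hall_mulA.
Qed.

Lemma rho_wordX (g : generator S) : rho_word (fmu g) = kappa (val g).
Proof. by rewrite /rho_word fmuE /= hall_mulr1. Qed.

Lemma rhoM x y : rho (x * y) = hall_mul (rho x) (rho y).
Proof.
apply: (eq_bilinear_malg (b := fun x y => rho (x * y))
  (b' := fun x y => hall_mul (rho x) (rho y))) => [z|z|z|z|w w'].
- by move=> c u v; rewrite malg_mul_linear_l linearP.
- by move=> c u v; rewrite malg_mul_linear_r linearP.
- by move=> c u v; rewrite linearP hall_mul_linear_l.
- by move=> c u v; rewrite linearP hall_mul_linear_r.
by rewrite malgUM !rhoU rho_wordM.
Qed.

Lemma X_val (g : generator S) : X (val g) = << fmu g >>.
Proof. by rewrite /X valK. Qed.

Lemma X0 (a : K0plus S) : val a = 0 -> X a = 1.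
Proof. by move=> a0; rewrite /X insubF // a0 eqxx. Qed.

Lemma rhoX (a : K0plus S) : rho (X a) = kappa a.
Proof.
have [a0|a0] := eqVneq (val a) 0.
  by rewrite X0 // kappa0 // rhoU rho_word1.
have -> : a = val (exist (fun a : K0plus S => val a != 0) a a0 : generator S) by [].
by rewrite X_val rhoU rho_wordX.
Qed.

End Rho.

(** * Compatibility with the coproduct and the counit *)

Section Coproduct.
Variable S : Type.
Implicit Types (f g h : hall S) (A B : Iso S).

Lemma hall_comul_linear : linear (@hall_comul S).
Proof.
move=> c f g; apply/malgP => -[A B].
rewrite mcoeffD mcoeffZ !hall_comulE.
by rewrite mcoeffD mcoeffZ.
Qed.

(** The value at [(A, B)] of the product of [x] and [y] in the tensor square of the
    Hall algebra. *)
Definition hall_tens_mul (x y : {malg rat[(Iso S * Iso S)%type]}) A B : rat :=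
  \sum_(U : {set vert (representative A)} | closed_in setT U)
  \sum_(V : {set vert (representative B)} | closed_in setT V)
    x@_(restr_class U, restr_class V) * y@_(restr_class (~: U), restr_class (~: V)).

Lemma hall_tens_mul_linear_l c x x' y A B :
  hall_tens_mul (c *: x + x') y A B = c * hall_tens_mul x y A B +
    hall_tens_mul x' y A B.
Proof.
rewrite mulr_sumr -big_split; apply: eq_bigr => U _.
rewrite mulr_sumr -big_split; apply: eq_bigr => V _.
by rewrite mcoeffD mcoeffZ mulrDl mulrA.
Qed.

Lemma hall_tens_mul_linear_r c x y y' A B :
  hall_tens_mul x (c *: y + y') A B = c * hall_tens_mul x y A B +
    hall_tens_mul x y' A B.
Proof.
rewrite mulr_sumr -big_split; apply: eq_bigr => U _.
rewrite mulr_sumr -big_split; apply: eq_bigr => V _.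
by rewrite mcoeffD mcoeffZ mulrDr mulrCA.
Qed.

Lemma mcoeff_hall_comulM f g A B : (hall_comul (hall_mul f g))@_(A, B) =
  hall_tens_mul (hall_comul f) (hall_comul g) A B.
Proof.
rewrite hall_comulE hall_mul_oplus; apply: eq_bigr => U _; apply: eq_bigr => V _.
by rewrite !hall_comulE.
Qed.

Lemma hall_tens_mul_tens f f' g g' A B :
  hall_tens_mul (tens f f') (tens g g') A B =
  (tens (hall_mul f g) (hall_mul f' g'))@_(A, B).
Proof.
rewrite mcoeff_tens !hall_mul_closed mulr_suml; apply: eq_bigr => U _.
rewrite mulr_sumr; apply: eq_bigr => V _.
by rewrite !mcoeff_tens mulrACA.
Qed.

HB.instance Definition _ := GRing.isLinear.Build rat (hall S)
  {malg rat[(Iso S * Iso S)%type]} *:%R (@hall_comul S) hall_comul_linear.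

HB.instance Definition _ := GRing.isLinear.Build rat (NC S)
  {malg rat[(word S * word S)%type]} *:%R (@NC_comul S) (linext_is_linear _).

Local Notation rho_rho := (tensmap (@rho S) (@rho S)).

Lemma tensmap_rhoU (v w : word S) :
  rho_rho << (v, w) >> = tens (rho S << v >>) (rho S << w >>).
Proof. exact: tensmapU. Qed.

Lemma word_pairM (v v' w w' : word S) :
  << (v, v') >> * << (w, w') >> =
    << (mmul v w, mmul v' w') >> :> {malg rat[(word S * word S)%type]}.
Proof. exact: malgUM. Qed.

Lemma rhoUM (v w : word S) :
  rho S << mmul v w >> = hall_mul (rho S << v >>) (rho S << w >>).
Proof. exact: etrans (congr1 (rho S) (esym (malgUM v w))) (rhoM _ _). Qed.

Lemma mcoeff_tensmap_rhoUM (v v' w w' : word S) A B :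
  (rho_rho (<< (v, v') >> * << (w, w') >>))@_(A, B) =
  hall_tens_mul (rho_rho << (v, v') >>) (rho_rho << (w, w') >>) A B.
Proof.
pose vw := tens (hall_mul (rho S << v >>) (rho S << w >>))
  (hall_mul (rho S << v' >>) (rho S << w' >>)).
have TM : rho_rho (<< (v, v') >> * << (w, w') >>) = vw.
  exact: etrans (congr1 rho_rho (word_pairM v v' w w')) (etrans (tensmap_rhoU _ _)
    (congr2 (@tens _ _) (rhoUM v w) (rhoUM v' w'))).
pose value_at (z : {malg rat[(Iso S * Iso S)%type]}) := z@_(A, B).
transitivity (value_at vw); first exact: (f_equal value_at TM).
exact: etrans (esym (hall_tens_mul_tens _ _ _ _ A B))
  (congr2 (fun x y => hall_tens_mul x y A B)
    (esym (tensmap_rhoU v v')) (esym (tensmap_rhoU w w'))).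
Qed.

(** The tensor square of [rho] is multiplicative because [rho] is. *)
Lemma mcoeff_tensmap_rhoM x y A B :
  (rho_rho (x * y))@_(A, B) = hall_tens_mul (rho_rho x) (rho_rho y) A B.
Proof.
pose b x y : rat^o := (rho_rho (x * y))@_(A, B).
pose b' x y : rat^o := hall_tens_mul (rho_rho x) (rho_rho y) A B.
have TP : linear rho_rho by exact: linearP.
apply: (eq_bilinear_malg (b := b) (b' := b')) x y => [z|z|z|z|p q] /=.
- by move=> c u v; rewrite /b malg_mul_linear_l TP mcoeffD mcoeffZ.
- by move=> c u v; rewrite /b malg_mul_linear_r TP mcoeffD mcoeffZ.
- by move=> c u v; rewrite /b' TP; apply: hall_tens_mul_linear_l.
- by move=> c u v; rewrite /b' TP; apply: hall_tens_mul_linear_r.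
by case: p q => [v v'] [w w']; apply: mcoeff_tensmap_rhoUM.
Qed.

Lemma hall_comul1 : hall_comul (hall_one S) = tens (hall_one S) (hall_one S).
Proof.
apply/malgP => -[A B]; rewrite hall_comulE mcoeff_tens !mcoeff_hall_one.
rewrite -{2}(representativeK A) -{2}(representativeK B) !iso_class_empty.
by rewrite /= card_sum !card_ord addn_eq0 -natrM mulnb.
Qed.

Lemma tensmap_rhoX (a b : K0plus S) :
  rho_rho (tens (X a) (X b)) = tens (kappa a) (kappa b).
Proof.
exact: etrans (tensmap_tens _ _ _ _) (congr2 (@tens _ _) (rhoX a) (rhoX b)).
Qed.

Lemma mcoeff_tensmap_X (a b : K0plus S) A B : (rho_rho (tens (X a) (X b)))@_(A, B) =
  (K0_class A == val a)%:R * (K0_class B == val b)%:R.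
Proof. by rewrite tensmap_rhoX mcoeff_tens (kappaE a) (kappaE b). Qed.

Lemma comul_genE (c : K0plus S) : comul_gen c =
  \sum_(p <- fset_set (fun p : K0plus S * K0plus S => val p.1 + val p.2 = val c))
    tens (X p.1) (X p.2).
Proof. by rewrite /comul_gen fsbig_finite //; apply: finite_K0plus_splittings. Qed.

(** At [(A, B)] the only splitting that contributes is [([A], [B])]. *)
Lemma hall_comul_kappa (c : K0plus S) : hall_comul (kappa c) = rho_rho (comul_gen c).
Proof.
apply/malgP => -[A B]; rewrite hall_comulE kappaE K0_class_oplus comul_genE.
rewrite linear_sum raddf_sum /=.
rewrite (eq_bigr _ (fun p _ => mcoeff_tensmap_X p.1 p.2 A B)).
have [ABc|ABc] := eqVneq (K0_class A + K0_class B) (val c).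
  pose a : K0plus S := exist (fun x => x \in @effective S) _ (K0_class_effective A).
  pose b : K0plus S := exist (fun x => x \in @effective S) _ (K0_class_effective B).
  rewrite (bigD1_seq (a, b)) ?fset_uniq //=; last first.
    by rewrite in_fset_set; [exact: classical_sets.mem_set|exact: finite_K0plus_splittings].
  rewrite !eqxx mulr1 big1 ?addr0 // => -[a' b']; rewrite xpair_eqE /= negb_and.
  rewrite -!(inj_eq val_inj) /= ![_ == val _]eq_sym => /orP [] /negbTE ->.
    by rewrite mul0r.
  by rewrite mulr0.
rewrite big_seq big1 // => -[a b]; rewrite in_fset_set; last exact: finite_K0plus_splittings.
move=> /classical_sets.set_mem /= abc; case: eqP => [Aa|]; last by rewrite mul0r.
case: eqP => [Bb|]; last by rewrite mulr0.
by rewrite Aa Bb abc eqxx in ABc.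
Qed.

(** Both coproducts are multiplicative, so that the letters of a word can be split
    off one at a time. *)
Lemma hall_comul_rho x : hall_comul (rho S x) = rho_rho (NC_comul x).
Proof.
apply: (@eq_linear_malg _ _ (@hall_comul S \o rho S) (rho_rho \o @NC_comul S));
  [exact: linearP|exact: linearP|move=> w /=].
rewrite rhoU [NC_comul _]linextU1 /rho_word.
elim: (fmonom_val w) => [|g s IHs] /=.
  rewrite big_nil hall_comul1; apply/esym/(etrans (tensmap_rhoU mone mone)).
  exact: congr2 (rho1 S) (rho1 S).
apply/malgP => -[A B]; rewrite mcoeff_hall_comulM IHs big_cons mcoeff_tensmap_rhoM.
by rewrite hall_comul_kappa.
Qed.

Lemma hall_counit_kappa (g : generator S) : hall_counit (kappa (val g)) = 0.
Proof.
by rewrite /hall_counit kappaE K0_class_empty eq_sym (negbTE (valP g)).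
Qed.

Lemma hall_counit_rho (x : NC S) : hall_counit (rho S x) = NC_counit x.
Proof.
rewrite /hall_counit /NC_counit.
pose l x : rat^o := (rho S x)@_(iso_class (empty_forest S)).
pose r (x : NC S) : rat^o := x@_(mone : word S).
apply: (@eq_linear_malg _ _ l r) => [c y z|c y z|w].
- by rewrite /l linearP mcoeffD mcoeffZ.
- by rewrite /r mcoeffD mcoeffZ.
rewrite /l /r rhoU mcoeffU1.
rewrite -[LHS]/(hall_counit _) /rho_word; case: w => -[|g s] /=.
  by rewrite /hall_counit mcoeffUU fmP fm1.
by rewrite hall_counitM hall_counit_kappa mul0r fmP fm1.
Qed.

End Coproduct.

(** * Leading terms and uniqueness of convolution inverses *)

Section LeadingTerm.
Variable S : Type.

Definition word_degree (w : word S) : nat :=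
  \sum_(g <- fmonom_val w) degree (val g).

Lemma word_degreeM v w : word_degree (mmul v w) = (word_degree v + word_degree w)%N.
Proof. by rewrite /word_degree fmM big_cat. Qed.

Definition X_word (a : K0plus S) : word S :=
  if insub a is Some g then fmu (g : generator S) else mone.

Lemma XE (a : K0plus S) : X a = << X_word a >>.
Proof. by rewrite /X /X_word; case: insub. Qed.

Lemma word_degree_fmu (g : generator S) : word_degree (fmu g) = degree (val g).
Proof. by rewrite /word_degree fmuE big_seq1. Qed.

Lemma word_degree_X (a : K0plus S) : (word_degree (X_word a) <= degree a)%N.
Proof.
rewrite /X_word; case: insubP => [g _ <-|_]; first by rewrite word_degree_fmu.
by rewrite /word_degree fm1 big_nil.
Qed.

(** Terms of this kind are negligible in the induction on the degree of the left
    tensor factor. *)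
Definition left_degree_lt n (y : {malg rat[(word S * word S)%type]}) : Prop :=
  forall p, p \in msupp y -> (word_degree p.1 < n)%N.

Lemma left_degree_ltD n y z :
  left_degree_lt n y -> left_degree_lt n z -> left_degree_lt n (y + z).
Proof.
by move=> yn zn p /(fsubsetP (msuppD_le _ _)); rewrite in_fsetU => /orP [/yn|/zn].
Qed.

Lemma left_degree_lt_sum n (I : eqType) (r : seq I) (P : pred I) F :
  (forall i, i \in r -> P i -> left_degree_lt n (F i)) ->
  left_degree_lt n (\sum_(i <- r | P i) F i).
Proof.
move=> Fn; rewrite big_seq_cond; apply: big_ind => [p|y z|i /andP []].
- by rewrite msupp0.
- exact: left_degree_ltD.
- exact: Fn.
Qed.

Lemma left_degree_ltU n v w :
  (word_degree v < n)%N -> left_degree_lt n << (v, w) >>.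
Proof. by move=> vn p; rewrite msuppU oner_eq0 => /fset1P ->. Qed.

Lemma left_degree_ltM m n y z :
  left_degree_lt m.+1 y -> left_degree_lt n z -> left_degree_lt (m + n) (y * z).
Proof.
move=> ym zn p /msuppM_le [p1 [p2 [/ym p1m /zn p2n ->]]].
by rewrite word_degreeM -addnS leq_add.
Qed.

Lemma left_degree_ltMr m n y z :
  left_degree_lt m y -> left_degree_lt n.+1 z -> left_degree_lt (m + n) (y * z).
Proof.
move=> ym zn p /msuppM_le [p1 [p2 [/ym p1m /zn p2n ->]]].
by rewrite word_degreeM -addSn leq_add.
Qed.

Lemma left_degree_ltW m n y :
  (m <= n)%N -> left_degree_lt m y -> left_degree_lt n y.
Proof. by move=> mn ym p /ym pm; apply: leq_trans mn. Qed.

(** In a splitting a + b of the degree of a generator other than the leading one,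
    b is nonzero and so a has smaller degree. *)
Lemma comul_gen_lead (g : generator S) :
  exists2 y, comul_gen (val g) = << (fmu g, mone) >> + y &
    left_degree_lt (degree (val g)) y.
Proof.
have z0 : (0 : K0 S) \in @effective S.
  by rewrite -(K0_class_empty S) K0_class_effective.
pose z : K0plus S := exist (fun x => x \in @effective S) 0 z0.
rewrite comul_genE (bigD1_seq (val g, z)) ?fset_uniq //=; last first.
  rewrite in_fset_set; last exact: finite_K0plus_splittings.
  by apply: classical_sets.mem_set; rewrite /= addr0.
rewrite X_val X0 // tensUU; eexists; first by [].
apply: left_degree_lt_sum => -[a b].
rewrite in_fset_set; last exact: finite_K0plus_splittings.
move=> /classical_sets.set_mem /= abg neq_ab; rewrite !XE tensUU.
apply/left_degree_ltU/(leq_ltn_trans (word_degree_X a)).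
rewrite (degreeD abg) -addn1 leq_add2l degree_gt0 //.
apply: contraNneq neq_ab => b0; rewrite b0 addr0 in abg.
by apply/eqP; congr (_, _); apply: val_inj.
Qed.

Lemma NC_comul_lead (w : word S) :
  exists2 y, NC_comul << w >> = << (w, mone) >> + y &
    left_degree_lt (word_degree w) y.
Proof.
have -> : NC_comul << w >> = \prod_(g <- fmonom_val w) comul_gen (val g).
  exact: linextU1.
case: w => s; rewrite /word_degree -[fmonom_val _]/s.
elim: s => [|g s [z zE zlt]].
  rewrite big_nil; exists 0; last by move=> p; rewrite msupp0.
  by rewrite addr0 -fmoneE.
have [y yE ylt] := comul_gen_lead g.
rewrite !big_cons yE zE mulrDl mulrDr.
have -> : << (fmu g, mone) >> * << (FMonom s, mone) >> =
    << (FMonom (g :: s), mone) >> :> {malg rat[(word S * word S)%type]}.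
  rewrite word_pairM; congr << (_, _) >>; last exact: mulm1.
  by apply/eqP; rewrite fmP fmM fmuE.
rewrite -addrA; eexists; first by [].
apply: left_degree_ltD.
  apply: left_degree_ltM => //; apply: left_degree_ltU.
  by rewrite word_degree_fmu.
apply: left_degree_ltMr => //; apply: left_degree_ltD.
  exact: left_degree_ltU.
by apply: left_degree_ltW zlt.
Qed.

(** The leading term of the coproduct of a word [w] contributes [f w] itself to the
    convolution of [f] with [rho], and the other terms only involve values of
    [f] in smaller degree. *)
Lemma rho_convolution_inj (f g : {linear NC S -> hall S}) :
    (forall w : word S,
      linext (fun p => hall_mul (f << p.1 >>) (rho S << p.2 >>)) (NC_comul << w >>) =
      linext (fun p => hall_mul (g << p.1 >>) (rho S << p.2 >>)) (NC_comul << w >>)) ->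
  f =1 g.
Proof.
move=> fg; apply: eq_linear_malg => [||w]; [exact: linearP|exact: linearP|].
have [n] := ubnP (word_degree w); elim: n w => // n IHn w wn.
have := fg w; have [y -> ylt] := NC_comul_lead w.
have split_lead (h : {linear NC S -> hall S}) :
    linext (fun p => hall_mul (h << p.1 >>) (rho S << p.2 >>)) (<< (w, mone) >> + y) =
    h << w >> + linext (fun p => hall_mul (h << p.1 >>) (rho S << p.2 >>)) y.
  rewrite linearD; congr (_ + _); apply: etrans (linextU1 _ _) _.
  rewrite [LHS]/= rhoU rho_word1; exact: hall_mulr1.
rewrite !split_lead.
have -> : linext (fun p => hall_mul (f << p.1 >>) (rho S << p.2 >>)) y =
    linext (fun p => hall_mul (g << p.1 >>) (rho S << p.2 >>)) y.
  apply: eq_big_seq => p /ylt pw; rewrite IHn //.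
  exact: leq_trans pw wn.
exact: addIr.
Qed.

End LeadingTerm.

(** * The theorem *)

Theorem theorem1 (S : Type) :
  exists rho : {linear NC S -> hall S},
    [/\ is_algebra_hom (NC_ops S) (hall_ops S) rho /\
        (forall a : K0plus S, rho (X a) = kappa a),
        (forall rho' : {linear NC S -> hall S},
           is_algebra_hom (NC_ops S) (hall_ops S) rho' /\
           (forall a : K0plus S, rho' (X a) = kappa a) ->
           forall x, rho' x = rho x)
      & is_Hopf_hom (NC_ops S) (hall_ops S) rho].
Proof.
have rho_hom : is_algebra_hom (NC_ops S) (hall_ops S) (rho S).
  by split; [exact: rho1|exact: rhoM].
exists (rho S); split; first by split=> //; exact: rhoX.
  move=> rho' [[rho'1 rho'M] rho'X].
  apply: eq_linear_malg => [||[s]]; [exact: linearP|exact: linearP|].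
  elim: s => [|g s IHs].
    by rewrite -fmoneE; apply: etrans rho'1 (esym (rho1 S)).
  have -> : << FMonom (g :: s) >> = X (val g) * << FMonom s >> :> NC S.
    rewrite X_val malgUM; congr << _ >>.
    by apply/eqP; rewrite fmP fmM fmuE.
  by rewrite rhoM rhoX -IHs -rho'X; apply: rho'M.
split=> //; first by split; [exact: hall_comul_rho|exact: hall_counit_rho].
move=> sA sB antA antB.
apply: (rho_convolution_inj (f := rho S \o sA) (g := sB \o rho S)) => w.
(* Both sides are left convolution inverses of rho: the first because rho is an
   algebra homomorphism, the second because it is a coalgebra homomorphism. *)
transitivity (NC_counit << w >> *: hall_one S).
  have [antAw _] := antA << w >>; rewrite -(rho1 S) -linearZ -[RHS](congr1 (rho S) antAw).
  rewrite /convolution /linext linear_sum; apply: eq_bigr => p _.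
  by rewrite linearZ rhoM.
have [antBw _] := antB (rho S << w >>).
rewrite -hall_counit_rho -[LHS]antBw /convolution /= hall_comul_rho.
rewrite /tensmap linear_linext; apply: eq_bigr => p _; congr (_ *: _).
by apply: (linext_tens (b := fun u v => hall_mul (sB u) v)) => [v|u] c a b;
  rewrite ?linearP ?hall_mul_linear_l ?hall_mul_linear_r.
Qed.
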